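(* Let $p$ be a prime, $d\ge 2$ a natural number, and $\sigma,b$ positive real numbers. Let $\vec X$ be the max-norm process in $\mathbb{Q}_p^d$ with diffusion constant $\sigma$ and diffusion exponent $b$. For any positive real number $t$, the components $X_t^{(1)},\dots,X_t^{(d)}$ of $\vec X_t$ are not independent.
   Context: $|\cdot|$ is the $p$-adic absolute value on $\mathbb{Q}_p$, $\|\vec x\|=\max_i|x_i|$ is the max-norm on $\mathbb{Q}_p^d$, and $\mu_d$ is the Haar measure on $\mathbb{Q}_p^d$ normalized by $\mu_d(\mathbb{Z}_p^d)=1$. $\chi(x)=e^{2\pi\sqrt{-1}\{x\}}$ is the standard additive character of $\mathbb{Q}_p$, with $\{x\}$ the $p$-adic fractional part. For $t>0$ put $\rho_d(t,\vec x)=\int_{\mathbb{Q}_p^d}\chi(\vec x\cdot\vec y)\,e^{-\sigma t\|\vec y\|^b}\,d\mu_d(\vec y)$, a probability density on $\mathbb{Q}_p^d$. $P^d$ is the probability measure on the Skorohod space $D([0,\infty):\mathbb{Q}_p^d)$ of càdlàg paths, concentrated on paths starting at $\vec 0$, under which increments over disjoint time intervals are independent and $\omega(t)-\omega(s)$, $0\le s<t$, has density $\rho_d(t-s,\cdot)$. The max-norm process is $\vec X_t(\omega)=\omega(t)$ under $P^d$, with components $\vec X_t=(X_t^{(1)},\dots,X_t^{(d)})$; in particular $\vec X_t$ has density $\rho_d(t,\cdot)$. *)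

(* Defs.v *)
From HB Require Import structures.
From mathcomp Require Import all_boot all_order all_algebra.
From mathcomp Require Import ring_quotient complex.
From mathcomp Require Import all_classical all_reals all_analysis.
From mathcomp Require Import ring lra zify.
Set Implicit Arguments.
Unset Strict Implicit.
Unset Printing Implicit Defensive.
Import Order.TTheory GRing.Theory Num.Theory.
Import numFieldNormedType.Exports.
Local Open Scope classical_set_scope.
Local Open Scope ring_scope.

Section rational_padic_abs.
Variables (R : realType) (p : nat).

(* The p-adic absolute value on the rationals, |a/b| = p^(v(b) - v(a)). *)
Definition qabs (q : rat) : R :=
  if q == 0 then 0
  else p%:R ^ ((logn p `|denq q|)%:Z - (logn p `|numq q|)%:Z).

Variable p_pr : prime p.

Let pneq0 : (p%:R : R) != 0.
Proof. by rewrite pnatr_eq0 -lt0n prime_gt0. Qed.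

Lemma qabs_div (a b : int) : a != 0 -> b != 0 ->
  qabs (a%:~R / b%:~R) = p%:R ^ ((logn p `|b|)%:Z - (logn p `|a|)%:Z).
Proof.
move=> a0 b0; rewrite /qabs mulf_eq0 invr_eq0 !intr_eq0 (negPf a0) (negPf b0) /=.
set q : rat := _ / _.
have q0 : q != 0 by rewrite mulf_neq0 ?invr_eq0 ?intr_eq0.
have : a * denq q = numq q * b.
  apply: (@intr_inj rat); rewrite !rmorphM/=.
  by rewrite numqE mulrAC /q divfK// intr_eq0.
move=> /(congr1 (fun x : int => `|x|%N)); rewrite !abszM => /(congr1 (logn p)).
rewrite !lognM ?absz_gt0 ?denq_neq0 ?numq_eq0//; last first.
by move=> h; congr (_ ^ _); lia.
Qed.

Lemma qabs0 : qabs 0 = 0. Proof. by rewrite /qabs eqxx. Qed.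

Lemma qabs_gt0 q : q != 0 -> 0 < qabs q.
Proof. by move=> q0; rewrite /qabs (negPf q0) exprz_gt0// ltr0n prime_gt0. Qed.

Lemma qabs_eq0 q : (qabs q == 0) = (q == 0).
Proof.
have [->|q0] := eqVneq q 0; first by rewrite qabs0 eqxx.
by apply/negbTE; rewrite gt_eqF// qabs_gt0.
Qed.

Lemma qabs_ge0 q : 0 <= qabs q.
Proof. by have [->|/qabs_gt0/ltW//] := eqVneq q 0; rewrite qabs0. Qed.

Let ratP2 (q : rat) : q != 0 ->
  exists a b : int, [/\ a != 0, b != 0 & q = a%:~R / b%:~R].
Proof.
move=> q0; exists (numq q), (denq q).
by rewrite numq_eq0 q0 denq_neq0 divq_num_den.
Qed.

Lemma qabsM x y : qabs (x * y) = qabs x * qabs y.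
Proof.
have [->|x0] := eqVneq x 0; first by rewrite mul0r qabs0 mul0r.
have [->|y0] := eqVneq y 0; first by rewrite mulr0 qabs0 mulr0.
have [a [b [a0 b0 ->]]] := ratP2 x0.
have [c [e [c0 e0 ->]]] := ratP2 y0.
rewrite mulf_div -!rmorphM/= !qabs_div ?mulf_neq0// !abszM !lognM ?absz_gt0//.
by rewrite -expfzDr//; congr (_ ^ _); lia.
Qed.

Lemma qabs1 : qabs 1 = 1.
Proof. by rewrite /qabs/= !logn1 subrr expr0z. Qed.

Lemma qabsN x : qabs (- x) = qabs x.
Proof. by rewrite /qabs oppr_eq0 denqN numqN abszN. Qed.

Lemma qabsB x y : qabs (x - y) = qabs (y - x).
Proof. by rewrite -qabsN opprB. Qed.

Lemma qabsV x : qabs x^-1 = (qabs x)^-1.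
Proof.
have [->|x0] := eqVneq x 0; first by rewrite invr0 qabs0 invr0.
have nx : qabs x != 0 by rewrite qabs_eq0.
by apply: (mulfI nx); rewrite -qabsM !mulfV// qabs1.
Qed.

Lemma qabs_int (a : int) : a != 0 -> qabs a%:~R = p%:R ^- logn p `|a|.
Proof.
move=> a0; have := @qabs_div a 1 a0 isT; rewrite divr1 => ->.
by rewrite logn1 sub0r -exprnN.
Qed.

Lemma qabs_int_le (a : int) k : (qabs a%:~R <= p%:R ^- k) = (p ^ k %| `|a|)%N.
Proof.
have [->|a0] := eqVneq a 0.
  by rewrite qabs0 absz0 dvdn0 invr_ge0 exprn_ge0.
rewrite qabs_int// lef_pV2 ?posrE ?exprn_gt0 ?ltr0n ?prime_gt0//.
by rewrite ler_eXn2l ?ltr1n ?prime_gt1// pfactor_dvdn// absz_gt0.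
Qed.

Lemma qabs_intD (a b : int) :
  qabs (a + b)%:~R <= Num.max (qabs a%:~R) (qabs b%:~R).
Proof.
wlog ba : a b / qabs b%:~R <= qabs a%:~R => [h|].
  case/orP: (le_total (qabs b%:~R) (qabs a%:~R)) => /h //.
  by rewrite addrC maxC.
rewrite (max_idPl ba); have [a0|a0] := eqVneq a 0.
  by move: ba; rewrite a0 add0r.
move: ba; rewrite (qabs_int a0) !qabs_int_le => pb.
have -> : (p ^ logn p `|a| %| `|(a + b)%R|)%N = ((p ^ logn p `|a|)%N%:Z %| a + b)%Z.
  by rewrite dvdzE.
by rewrite rpredD// dvdzE/= ?pfactor_dvdnn.
Qed.

Lemma qabsD x y : qabs (x + y) <= Num.max (qabs x) (qabs y).
Proof.
have c0 : 0 < qabs (denq x * denq y)%:~R.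
  by rewrite qabs_gt0// intr_eq0 mulf_neq0 ?denq_neq0.
rewrite -(ler_pM2r c0) maxr_pMl ?(ltW c0)// -!qabsM mulrDl.
have -> : x * (denq x * denq y)%:~R = (numq x * denq y)%:~R.
  by rewrite !rmorphM/= numqE mulrA.
have -> : y * (denq x * denq y)%:~R = (numq y * denq x)%:~R.
  by rewrite !rmorphM/= numqE; ring.
by rewrite -rmorphD qabs_intD.
Qed.

Lemma qabs_leD x y : qabs (x + y) <= qabs x + qabs y.
Proof. by rewrite (le_trans (qabsD x y))// ge_max lerDl lerDr !qabs_ge0. Qed.

Lemma qabs_dist x y : `|qabs x - qabs y| <= qabs (x - y).
Proof.
have h u v : qabs u - qabs v <= qabs (u - v).
  by rewrite lerBlDr -{1}(subrK v u) qabs_leD.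
by rewrite ler_norml h andbT lerNl opprB qabsB h.
Qed.

End rational_padic_abs.

(* Q_p as the completion of the rationals: Cauchy sequences for |.|_p modulo
   null sequences. The real numbers R in which absolute values are taken are a
   parameter, since the metric structure on Q_p depends on them. *)
Section padic_completion.
Variables (R : realType) (p : nat) (p_pr : prime p).
Local Notation abs := (qabs R p).

Definition qcauchy : {pred nat -> rat} := [pred u | `[< forall e : R, 0 < e ->
  exists N, forall m n, (N <= m)%N -> (N <= n)%N -> abs (u m - u n) < e >]].

Lemma qcauchy_cvg u : u \in qcauchy -> cvgn (abs \o u).
Proof.
move=> /asboolP cu; apply/cauchy_cvgP/cauchy_exP => e e0.
have [N uN] := cu e e0; exists (abs (u N)); exists N => // n /= Nn.
by rewrite /ball/= (le_lt_trans (qabs_dist _ _ _ _))// uN.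
Qed.

Lemma qcauchy_bounded u : u \in qcauchy ->
  exists2 M : R, 0 < M & forall n, abs (u n) <= M.
Proof.
move=> /qcauchy_cvg/cvg_seq_bounded[M [_ /(_ (Num.max 1 (M + 1)))]] h.
exists (Num.max 1 (M + 1)); first by rewrite lt_max ltr01.
move=> n; rewrite (le_trans (ler_norm _))//; apply: h => //.
by rewrite lt_max ltrDl ltr01 orbT.
Qed.

Lemma qcauchy_subring : subring_closed qcauchy.
Proof.
split=> [|u v|u v].
- apply/asboolP => e e0; exists 0%N => m n _ _.
  by rewrite subrr qabs0.
- move=> /asboolP cu /asboolP cv; apply/asboolP => e e0.
  have [[N1 uN] [N2 vN]] := (cu e e0, cv e e0).
  exists (maxn N1 N2) => m n; rewrite !geq_max => /andP[? ?] /andP[? ?].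
  have -> : (u - v) m - (u - v) n = (u m - u n) + (v n - v m).
    by rewrite !fctE; ring.
  by rewrite (le_lt_trans (qabsD _ p_pr _ _))// gt_max uN// vN.
- move=> cu cv.
  have [[M M0 uM] [K K0 vK]] := (qcauchy_bounded cu, qcauchy_bounded cv).
  move: cu cv => /asboolP cu /asboolP cv; apply/asboolP => e e0.
  have [N1 uN] := cu _ (divr_gt0 e0 K0).
  have [N2 vN] := cv _ (divr_gt0 e0 M0).
  exists (maxn N1 N2) => m n; rewrite !geq_max => /andP[? ?] /andP[? ?].
  have -> : (u * v) m - (u * v) n = (u m - u n) * v m + u n * (v m - v n).
    by rewrite !fctE; ring.
  rewrite (le_lt_trans (qabsD _ p_pr _ _))// gt_max !qabsM//; apply/andP; split.
    rewrite (@le_lt_trans _ _ (abs (u m - u n) * K))//.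
      by rewrite ler_wpM2l// qabs_ge0.
    by rewrite -ltr_pdivlMr// uN.
  rewrite (@le_lt_trans _ _ (M * abs (v m - v n)))//.
    by rewrite ler_wpM2r// qabs_ge0.
  by rewrite mulrC -ltr_pdivlMr// vN.
Qed.

(* The primality proof is a phantom parameter of the type: the ring structure
   below depends on it. *)
Record cauchyseq_of (pp : prime p) := CauchySeq {
  cauchyseq_val :> nat -> rat ; cauchyseqP : cauchyseq_val \in qcauchy }.
Local Notation cauchyseq := (cauchyseq_of p_pr).

HB.instance Definition _ := [isSub for @cauchyseq_val p_pr].
HB.instance Definition _ := [Choice of cauchyseq by <:].
HB.instance Definition _ :=
  GRing.SubChoice_isSubComNzRing.Build _ _ cauchyseq qcauchy_subring.

Definition qnull : {pred cauchyseq} :=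
  [pred u : cauchyseq | `[< abs \o u @ \oo --> (0 : R) >]].

Lemma qnull_ideal : idealr_closed qnull.
Proof.
split=> [||a u v /asboolP u0 /asboolP v0].
- apply/asboolP; rewrite (_ : _ \o _ = cst 0); first exact: cvg_cst.
  by apply/funext => n /=; rewrite qabs0.
- apply/asboolP; rewrite (_ : _ \o _ = cst 1); last first.
    by apply/funext => n /=; rewrite qabs1.
  move=> /(cvg_lim (@Rhausdorff R)); rewrite (lim_cst (@Rhausdorff R)) => /eqP.
  by rewrite oner_eq0.
- have [M M0 aM] := qcauchy_bounded (cauchyseqP a).
  apply/asboolP.
  apply: (@squeeze_cvgr _ _ _ _ (cst 0) (fun n => M * abs (u n) + abs (v n))).
  + near=> n; rewrite /= qabs_ge0//= (le_trans (qabs_leD _ p_pr _ _))//.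
    by rewrite lerD2r qabsM// ler_wpM2r ?qabs_ge0.
  + exact: cvg_cst.
  + rewrite -[X in _ --> X]addr0 -[X in _ --> X + _](mulr0 M).
    by apply: cvgD v0; apply: cvgMr u0.
Unshelve. all: by end_near. Qed.

HB.instance Definition _ := isIdealr.Build cauchyseq qnull qnull_ideal.

Definition padic : Type := {ideal_quot qnull}.

HB.instance Definition _ := GRing.ComNzRing.on padic.

Local Notation cl u := (\pi_({ideal_quot qnull})%qT u : padic).

Lemma padicP (x : padic) : exists u : cauchyseq, x = cl u.
Proof. by exists (repr (x : {ideal_quot qnull})); rewrite reprK. Qed.

Lemma cl_eq0 (u : cauchyseq) : cl u = 0 <-> abs \o u @ \oo --> (0 : R).
Proof.
split=> [/eqP|u0].
  by rewrite -[0](@pi_zeror _ _ _ _ _ {ideal_quot qnull}) -Quotient.idealrBE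
    subr0 => /asboolP.
apply/eqP; rewrite -[0](@pi_zeror _ _ _ _ _ {ideal_quot qnull}).
by rewrite -Quotient.idealrBE subr0; exact/asboolP.
Qed.

Definition padic_abs (x : padic) : R :=
  limn (abs \o (repr (x : {ideal_quot qnull}) : cauchyseq)).

Lemma padic_abs_cl (u : cauchyseq) : abs \o u @ \oo --> padic_abs (cl u).
Proof.
set v : cauchyseq := repr (\pi_({ideal_quot qnull})%qT u).
have cv : abs \o v @ \oo --> padic_abs (cl u) by exact: qcauchy_cvg (cauchyseqP v).
have uv : abs \o (u - v) @ \oo --> (0 : R).
  by apply/cl_eq0; rewrite raddfB/= reprK subrr.
have uv' : (abs \o u) \- (abs \o v) @ \oo --> (0 : R).
  apply/norm_cvg0P; apply: (squeeze_cvgr _ (cvg_cst 0) uv).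
  by near=> n; rewrite /= normr_ge0/= qabs_dist.
have -> : abs \o u = ((abs \o u) \- (abs \o v)) \+ (abs \o v).
  by apply/funext => n /=; rewrite subrK.
by rewrite -[X in _ --> X]add0r; exact: cvgD uv' cv.
Unshelve. all: by end_near. Qed.

Lemma padic_abs_limE (u : cauchyseq) (l : R) :
  abs \o u @ \oo --> l -> padic_abs (cl u) = l.
Proof.
move=> /(cvg_lim (@Rhausdorff R)) <-.
by rewrite (cvg_lim (@Rhausdorff R) (@padic_abs_cl u)).
Qed.

Lemma padic_abs_eq0 x : padic_abs x = 0 <-> x = 0.
Proof.
have [u ->] := padicP x; split=> [h|/cl_eq0/padic_abs_limE//].
by apply/cl_eq0; rewrite -[X in _ --> X]h; exact: padic_abs_cl.
Qed.

Lemma padic_absM x y : padic_abs (x * y) = padic_abs x * padic_abs y.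
Proof.
have [[u ->] [v ->]] := (padicP x, padicP y).
rewrite -rmorphM; apply: padic_abs_limE.
rewrite (_ : _ \o _ = (abs \o u) \* (abs \o v)).
  exact: cvgM (@padic_abs_cl u) (@padic_abs_cl v).
by apply/funext => n; rewrite /= qabsM.
Qed.

Lemma padic_absN x : padic_abs (- x) = padic_abs x.
Proof.
have [u ->] := padicP x; rewrite -rmorphN; apply: padic_abs_limE.
rewrite (_ : _ \o _ = abs \o u); first exact: padic_abs_cl.
by apply/funext => n; rewrite /= qabsN.
Qed.

Lemma padic_abs_ge0 x : 0 <= padic_abs x.
Proof.
have [u ->] := padicP x.
rewrite -(cvg_lim (@Rhausdorff R) (@padic_abs_cl u))//; apply: limr_ge.
  exact: cvgP (@padic_abs_cl u).
by near=> n; exact: qabs_ge0.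
Unshelve. all: by end_near. Qed.

Lemma padic_absD x y :
  padic_abs (x + y) <= Num.max (padic_abs x) (padic_abs y).
Proof.
have [[u ->] [v ->]] := (padicP x, padicP y).
rewrite -rmorphD; apply/ler_addgt0Pr => e e0.
rewrite -(cvg_lim (@Rhausdorff R) (@padic_abs_cl (u + v))).
apply: limr_le; first exact: cvgP (@padic_abs_cl (u + v)).
have ltM w l : padic_abs (cl w) <= l -> \forall n \near \oo, abs (w n) < l + e.
  move=> wl; apply: (cvgr_lt _ (@padic_abs_cl w)).
  by rewrite (le_lt_trans wl)// ltrDl.
near=> n; rewrite /= (le_trans (qabsD _ p_pr _ _))// ge_max.
by apply/andP; split; apply/ltW; near: n; apply: ltM; rewrite le_max lexx ?orbT.
Unshelve. all: by end_near. Qed.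

Lemma padic_leD x y : padic_abs (x + y) <= padic_abs x + padic_abs y.
Proof.
by rewrite (le_trans (padic_absD x y))// ge_max lerDl lerDr !padic_abs_ge0.
Qed.

Lemma padic_has_inv x : x != 0 -> exists y : padic, y * x = 1.
Proof.
have [u ->] := padicP x => u0.
have l0 : 0 < padic_abs (cl u).
  rewrite lt_neqAle padic_abs_ge0 andbT eq_sym; apply: contra u0.
  by move=> /eqP/padic_abs_eq0 ->.
set l := padic_abs (cl u) in l0.
have [N _ uN] : \forall n \near \oo, l / 2 < abs (u n).
  by apply: (cvgr_gt l (@padic_abs_cl u)); rewrite ltr_pdivrMr// ltr_pMr// ltr1n.
have cv : (fun n => (u n)^-1) \in qcauchy.
  apply/asboolP => e e0.
  have := cauchyseqP u => /asboolP /(_ (e * ((l / 2) * (l / 2)))).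
  have l20 : 0 < l / 2 by rewrite divr_gt0.
  case=> [|K uK]; first by rewrite !mulr_gt0.
  exists (maxn N K) => m n; rewrite !geq_max => /andP[Nm Km] /andP[Nn Kn].
  have um : 0 < abs (u m) by rewrite (lt_trans l20)// uN.
  have un : 0 < abs (u n) by rewrite (lt_trans l20)// uN.
  have -> : (u m)^-1 - (u n)^-1 = (u n - u m) / (u m * u n).
    have um0 : u m != 0 by rewrite -(qabs_eq0 R p_pr) gt_eqF.
    have un0 : u n != 0 by rewrite -(qabs_eq0 R p_pr) gt_eqF.
    by field; rewrite um0 un0.
  rewrite qabsM// qabsV// qabsM// ltr_pdivrMr ?mulr_gt0//.
  rewrite (lt_le_trans (uK _ _ _ _))// ler_wpM2l ?(ltW e0)//.
  by rewrite ler_pM ?(ltW l20)// ltW// uN.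
exists (cl (CauchySeq p_pr cv)); apply/eqP; rewrite -subr_eq0; apply/eqP.
rewrite -rmorphM -[1](rmorph1 \pi_({ideal_quot qnull})%qT) -rmorphB.
apply/cl_eq0; apply: cvg_near_cst; near=> n.
rewrite -[LHS]/(abs ((u n)^-1 * u n - 1)) mulVf ?subrr ?qabs0// -(qabs_eq0 R p_pr) gt_eqF// (@lt_trans _ _ (l / 2))//.
  by rewrite divr_gt0.
by apply: uN; near: n; exists N.
Unshelve. all: by end_near. Qed.

(* Inverse chosen classically; 0 when x = 0. *)
Definition padic_inv (x : padic) : padic := xget 0 [set y | y * x = 1].

Lemma padic_mulVf x : x != 0 -> padic_inv x * x = 1.
Proof. by move=> /padic_has_inv h; exact: (xgetPex 0 h). Qed.

Lemma padic_invr0 : padic_inv 0 = 0.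
Proof.
rewrite /padic_inv; case: xgetP => // y _ /eqP.
by rewrite mulr0 eq_sym oner_eq0.
Qed.

HB.instance Definition _ :=
  GRing.ComNzRing_isField.Build padic padic_mulVf padic_invr0.

Let padic_dist (x y : padic) := padic_abs (x - y).

Let padic_distxx x : padic_dist x x = 0.
Proof. by rewrite /padic_dist subrr; exact/padic_abs_eq0. Qed.

Let padic_dist_eq0 x y : padic_dist x y = 0 -> x = y.
Proof. by move=> /padic_abs_eq0/eqP; rewrite subr_eq0 => /eqP. Qed.

Let padic_dist_sym x y : padic_dist x y = padic_dist y x.
Proof. by rewrite /padic_dist -padic_absN opprB. Qed.

Let padic_dist_triangle y x z :
  padic_dist x z <= padic_dist x y + padic_dist y z.
Proof. by rewrite /padic_dist -(subrKA y) padic_leD. Qed.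

HB.instance Definition _ := isPointed.Build padic 0.
HB.instance Definition _ := isMetric.Build R padic
  padic_distxx padic_dist_eq0 padic_dist_sym padic_dist_triangle.

End padic_completion.

Section padic_fractional_part.
Variables (R : realType) (p : nat) (p_pr : prime p).
Local Notation Qp := (padic R p_pr).
Local Notation cl u := (\pi_({ideal_quot (@qnull R p p_pr)})%qT u : Qp).

Let cst_cauchy (q : rat) : cst q \in qcauchy R p.
Proof. by apply/asboolP => e e0; exists 0%N => m n _ _; rewrite subrr qabs0. Qed.

Let clc (q : rat) : Qp := cl (CauchySeq p_pr (cst_cauchy q)).

Let clcB : zmod_morphism clc.
Proof. by move=> x y; rewrite /clc -rmorphB; apply: congr1; exact/val_inj. Qed.

Let clcE (q : rat) : ratr q = clc q.
Proof.
have clcM : monoid_morphism clc.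
  split=> [|x y]; rewrite /clc.
    rewrite -[RHS](rmorph1 (\pi_({ideal_quot (@qnull R p p_pr)})%qT)).
    by apply: congr1; exact/val_inj.
  by rewrite -rmorphM; apply: congr1; exact/val_inj.
pose aM := GRing.isZmodMorphism.Build _ _ clc clcB.
pose mM := GRing.isMonoidMorphism.Build _ _ clc clcM.
pose f : {rmorphism rat -> Qp} := HB.pack clc aM mM.
exact/esym/(fmorph_eq_rat f).
Qed.

Lemma padic_ratrB (q r : rat) : ratr (q - r) = ratr q - ratr r :> Qp.
Proof. by rewrite !clcE clcB. Qed.

Lemma padic_abs_ratr (q : rat) : padic_abs (ratr q : Qp) = qabs R p q.
Proof.
rewrite clcE; apply: padic_abs_limE. apply: cvg_near_cst.
by near=> n. Unshelve. all: by end_near. Qed.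

Lemma padic_dense (x : Qp) (e : R) : 0 < e ->
  exists q : rat, padic_abs (x - ratr q) < e.
Proof.
move=> e0; have [u ->] := padicP x.
have e20 : 0 < e / 2 by rewrite divr_gt0.
have := cauchyseqP u => /asboolP /(_ _ e20)[N uN].
exists (u N); rewrite clcE /clc -rmorphB.
rewrite (@le_lt_trans _ _ (e / 2))//; last first.
  by rewrite ltr_pdivrMr// ltr_pMr// ltr1n.
rewrite -(cvg_lim (@Rhausdorff R) (@padic_abs_cl _ _ _ _)).
apply: limr_le; first exact: cvgP (@padic_abs_cl _ _ _ _).
by near=> n; apply/ltW/uN => //; near: n; exists N.
Unshelve. all: by end_near. Qed.

(* {x} is the element of Z[1/p] in [0, 1[ that differs from x by a p-adic
   integer, that is, the sum of the terms of negative exponent in the p-adic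
   expansion of x; padic_fracP and padic_frac_uniq: it exists and is unique. *)
Definition is_padic_frac (x : Qp) (q : rat) : Prop :=
  [/\ 0 <= q < 1, exists k, q * p%:R ^+ k \is a Num.int
    & padic_abs (x - ratr q) <= 1].

Definition padic_frac (x : Qp) : rat := xget 0 [set q | is_padic_frac x q].

Lemma padic_frac_uniq (x : Qp) q r :
  is_padic_frac x q -> is_padic_frac x r -> q = r.
Proof.
move=> [/andP[q0 q1] [k qk] xq] [/andP[r0 r1] [l rl] xr].
have qr1 : qabs R p (q - r) <= 1.
  rewrite -padic_abs_ratr padic_ratrB -(subrKA x).
  rewrite -[ratr q - x]opprB.
  by rewrite (le_trans (padic_absD _ _))// ge_max padic_absN xq xr.
have pN0 : (p%:R ^+ (k + l) : rat) != 0.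
  by rewrite expf_neq0// pnatr_eq0 -lt0n prime_gt0.
have /intrP[m mE] : (q - r) * p%:R ^+ (k + l) \is a Num.int.
  rewrite mulrBl {1}exprD mulrA addnC exprD mulrA.
  by apply: rpredB; apply: rpredM => //; apply: rpredX; exact: rpred_nat.
have : qabs R p m%:~R <= p%:R ^- (k + l).
  rewrite -mE qabsM// (_ : qabs R p (p%:R ^+ _) = p%:R ^- (k + l)).
    by rewrite ler_piMl// invr_ge0 exprn_ge0.
  rewrite -[p%:R ^+ _]/(p%:R ^+ (k + l)) -natrX -[X in qabs _ _ X]/((p ^ (k + l))%N%:Z%:~R).
  by rewrite qabs_int// ?absz_nat ?pfactorK// gt_eqF// ltz_nat expn_gt0 prime_gt0.
rewrite qabs_int_le// => mp.
have /dvdzP[z mz] : ((p ^ (k + l))%N%:Z %| m)%Z by rewrite dvdzE.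
have qrz : q - r = z%:~R.
  apply: (mulIf pN0); rewrite mE mz rmorphM/=; congr (_ * _).
  by rewrite -natrX.
have : `|q - r| < 1 by rewrite ltr_norml; apply/andP; split; lra.
rewrite qrz -intr_norm ltrz1 => z1; have z0 : z = 0 by lia.
by apply/eqP; rewrite -subr_eq0 qrz z0.
Qed.

Lemma padic_fracP (x : Qp) : is_padic_frac x (padic_frac x).
Proof.
suff [q xq] : exists q, is_padic_frac x q.
  by rewrite /padic_frac; case: xgetP => // /(_ q).
have [r xr] := padic_dense x (@ltr01 R).
have : (0 < `|denq r|)%N by rewrite absz_gt0 denq_neq0.
move=> /(pfactor_coprime p_pr)[b pb]; set k := logn _ _ => denE.
have denE' : denq r = b%:Z * (p ^ k)%N%:Z by rewrite -PoszM -denE gtz0_abs.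
have : coprimez b%:Z (p ^ k)%N%:Z by rewrite coprimezE/= coprime_sym coprimeXl.
move=> /coprimezP[[u v] /= uv1].
pose m := (numq r * u %% (p ^ k)%N)%Z.
pose t := (numq r * u %/ (p ^ k)%N)%Z.
have mt : numq r * u = t * (p ^ k)%N + m by exact: divz_eq.
have pk0 : (0 : rat) < p%:R ^+ k by rewrite exprn_gt0// ltr0n prime_gt0.
have b0 : b%:Z != 0 by apply: contraTneq (denq_gt0 r); rewrite denE' => ->.
exists (m%:~R / p%:R ^+ k); split.
- rewrite divr_ge0 ?(ltW pk0) ?ler0z ?modz_ge0//= ?ltr_pdivrMr ?mul1r//.
    by rewrite -natrX pmulrn ltr_int ltz_pmod// ltz_nat expn_gt0 prime_gt0.
  by rewrite gt_eqF// ltz_nat expn_gt0 prime_gt0.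
- by exists k; rewrite divfK ?gt_eqF// intr_int.
- rewrite -(subrKA (ratr r)) (le_trans (padic_absD _ _))// ge_max (ltW xr)/=.
  rewrite -padic_ratrB padic_abs_ratr.
  have -> : r - m%:~R / p%:R ^+ k = (numq r * v + t * b%:Z)%:~R / b%:Z%:~R.
    have bQ : b%:Z%:~R != 0 :> rat by rewrite intr_eq0.
    have pQ : (p ^ k)%N%:Z%:~R != 0 :> rat.
      by rewrite intr_eq0 gt_eqF// ltz_nat expn_gt0 prime_gt0.
    rewrite -natrX -{1}[r]divq_num_den denE' pmulrn.
    have -> : m = numq r * u - t * (p ^ k)%N by rewrite mt addrC addKr.
    rewrite !(rmorphM, rmorphB, rmorphD)/=.
    have : u%:~R * b%:Z%:~R + v%:~R * (p ^ k)%N%:Z%:~R = 1 :> rat.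
      by rewrite -!rmorphM -rmorphD /= uv1.
    set B : rat := b%:Z%:~R in bQ *; set K : rat := (p ^ k)%N%:Z%:~R in pQ *.
    move=> uvQ; have -> : (numq r)%:~R / (B * K) =
      (numq r)%:~R * (u%:~R * B + v%:~R * K) / (B * K) by rewrite uvQ mulr1.
    by field; rewrite bQ pQ.
  rewrite qabsM// qabsV// (@qabs_int _ _ p_pr b)//.
  have -> : logn p `|b%:Z| = 0%N by rewrite absz_nat logn_coprime.
  rewrite expr0 !invr1 mulr1.
  have := @qabs_int_le R _ p_pr (numq r * v + t * b%:Z) 0.
  by rewrite expr0 invr1 expn0 dvd1n => ->.
Qed.
End padic_fractional_part.

Local Open Scope complex_scope.

Section complex_integral.
Context {R : realType} {dT : measure_display} {T : measurableType dT}.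

(* Only meaningful when the real and imaginary parts are integrable on D. *)
Definition Cintegral (mu : {measure set T -> \bar R}) (D : set T)
    (f : T -> R[i]) : R[i] :=
  (\int[mu]_(x in D) complex.Re (f x)) +i* (\int[mu]_(x in D) complex.Im (f x)).

End complex_integral.

Section independence.
Context {R : realType} {dT dE : measure_display} {T : measurableType dT}
  {E : measurableType dE}.

Definition independent_RVs (P : probability T R) (I : finType)
    (X : I -> T -> E) : Prop :=
  forall (J : {set I}) (B : I -> set E), (forall i, measurable (B i)) ->
    P (\bigcap_(i in [set` J]) (X i @^-1` B i)) =
    (\prod_(i in J) P (X i @^-1` B i))%E.

End independence.

Notation borel T := (g_sigma_algebraType (@open T)).

Section skorohod_space.
Variables (R : realType) (E : ptopologicalType).

(* Paths are indexed by [0, +oo); a path is stored as a function on R that is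
   constant on ]-oo, 0], so that equal paths are equal functions. *)
Record skorohod := Skorohod {
  skpath :> R -> E ;
  skpath_neg : forall t : R, t < 0 -> skpath t = skpath 0 ;
  skpath_right : forall t : R, 0 <= t -> skpath s @[s --> t^'+] --> skpath t ;
  skpath_left : forall t : R, 0 < t -> cvg (skpath s @[s --> t^'-]) }.

HB.instance Definition _ := gen_eqMixin skorohod.
HB.instance Definition _ := gen_choiceMixin skorohod.

Program Definition skorohod_cst (x : E) := @Skorohod (cst x) _ _ _.
Next Obligation. by []. Qed.
Next Obligation. by move=> x t _; exact: cvg_cst. Qed.
Next Obligation. by move=> x t _; exact: is_cvg_cst. Qed.

HB.instance Definition _ := isPointed.Build skorohod (skorohod_cst point).

Definition cylinder_sets : set (set skorohod) := [set A | exists2 t : R, 0 <= t &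
  exists2 B : set (borel E), measurable B & A = [set w : skorohod | B (w t)]].

End skorohod_space.

Notation path_space R E := (g_sigma_algebraType (@cylinder_sets R E)).

Section max_norm_process.
Variables (R : realType) (p : nat) (p_pr : prime p).
Local Notation Qp := (padic R p_pr).

(* exp(2 pi i {x}), written with cos and sin. *)
Definition padic_char (x : Qp) : R[i] :=
  let theta := 2 * pi * ratr (padic_frac x) in cos theta +i* sin theta.

Variable d : nat.
Local Notation Qpd := 'rV[Qp]_d.

Definition dot (x y : Qpd) : Qp := \sum_i x 0 i * y 0 i.

Definition max_norm (x : Qpd) : R := \big[Num.max/0]_i padic_abs (x 0 i).

(* haar_unit: the closed unit polydisc is Z_p^d. Regularity is automatic, open
   subsets of Q_p^d being sigma-compact. *)
Record normalized_haar (mu : {measure set (borel Qpd) -> \bar R}) : Prop := {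
  haar_shift : forall (a : Qpd) (A : set (borel Qpd)), measurable A ->
    mu [set a + x | x in A] = mu A ;
  haar_compact : forall K : set Qpd, compact K -> (mu K < +oo)%E ;
  haar_unit : mu [set x : Qpd | forall i, padic_abs (x 0 i) <= 1] = 1%E }.

Definition rho (mu : {measure set (borel Qpd) -> \bar R}) (sigma b t : R)
    (x : Qpd) : R[i] :=
  Cintegral mu setT (fun y : Qpd =>
    padic_char (dot x y) * (expR (- (sigma * t * (max_norm y `^ b))))%:C).

(* law_density: P(w t - w s \in B) is compared in R[i] with the integral over B
   of rho, which is complex-valued by definition. *)
Record max_norm_law (mu : {measure set (borel Qpd) -> \bar R}) (sigma b : R)
    (P : probability (path_space R Qpd) R) : Prop := {
  law_start : P [set w : path_space R Qpd | w 0 = 0] = 1%E ;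
  law_indep : forall (n : nat) (s t : 'I_n -> R),
    (forall i, 0 <= s i < t i) ->
    trivIset setT (fun i => `]s i, t i]%classic) ->
    independent_RVs P
      (fun i (w : path_space R Qpd) => (w (t i) - w (s i) : borel Qpd)) ;
  law_density : forall s t : R, 0 <= s -> s < t ->
    forall B : set (borel Qpd), measurable B ->
    (fine (P [set w : path_space R Qpd | B (w t - w s)]))%:C =
    Cintegral mu B (rho mu sigma b (t - s)) }.

Definition max_norm_component (t : R) (i : 'I_d) (w : path_space R Qpd) : borel Qp :=
  w t 0 i.

End max_norm_process.

(* Main.v *)
Require Import Defs.
From HB Require Import structures.
From mathcomp Require Import all_boot all_order all_algebra.
From mathcomp Require Import complex.
From mathcomp Require Import all_classical all_reals all_analysis measurable_realfun.
From mathcomp Require Import ring lra zify.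
Set Implicit Arguments.
Unset Strict Implicit.
Unset Printing Implicit Defensive.
Import Order.TTheory GRing.Theory Num.Theory.
Import numFieldNormedType.Exports.
Local Open Scope classical_set_scope.
Local Open Scope ring_scope.

(** Write g(y) = exp(- sigma t ||y||^b), the characteristic function of X_t, and
    call box a product of balls {x : |x_i| <= p^(n_i) for all i}, whose dual is
    the box with opposite exponents. Integrating rho over a box, exchanging the
    integrals and using the orthogonality of characters
    ([integral_cos_transform]) gives

      P (X_t in box) = mu(box) * (integral of g over the dual box).

    Since g depends on the max-norm only, the right-hand side is explicit for
    the boxes B_rs, r, s in {0, 1}, in which the first two coordinates have
    radii p^(-r) and p^(-s) and all the others radius 1. The dual box consists
    of Z_p^d and of points of norm exactly p, so that, with I the integral of g
    over Z_p^d and e = exp(- sigma t p^b) the value of g on the sphere of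
    radius p ([probability_box2]),

      P (X_t in B_rs) = p^(- (r + s)) * (I + (p^(r + s) - 1) * e).

    Independent components would make these masses multiplicative:
    P(B_11) P(B_00) = P(B_10) P(B_01). But the difference of the two sides is
    (p - 1)^2 p^(-2) e (I - e), which is positive because e > 0 and because g
    exceeds e on the whole of Z_p^d, a set of measure 1
    ([integral_radial_unit_gt], [box_masses_neq]).

    The exchange of integrals needs the integrability of g, which holds because
    mu {||y|| <= p^N} = p^(N d) grows more slowly than g decays
    ([integral_radial_lty]), and the joint measurability of the character,
    which follows from its being constant in y on the cosets of the dual box
    ([measurable_cos_dot_pair]). Only real parts are ever needed: the real part
    of the character satisfies the cosine addition formula ([padic_cosD]), and
    this is enough for orthogonality. *)

(** * Digits and fractional parts in Q_p *)

Section padic_theory.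
Context {R : realType} {p : nat} {p_pr : prime p}.
Local Notation Qp := (padic R p_pr).
Local Notation "`| x |_p" := (padic_abs x) (format "`| x |_p").
Implicit Types x y z : Qp.

Lemma p_gt0 : 0 < p%:R :> R.
Proof. by rewrite ltr0n prime_gt0. Qed.

Lemma p_gt1 : 1 < p%:R :> R.
Proof. by rewrite ltr1n prime_gt1. Qed.

Lemma padic_abs0 : `|0 : Qp|_p = 0.
Proof. exact/padic_abs_eq0. Qed.

Lemma padic_absB x y : `|x - y|_p = `|y - x|_p.
Proof. by rewrite -padic_absN opprB. Qed.

Lemma padic_absD_le x y (r : R) : `|x|_p <= r -> `|y|_p <= r -> `|x + y|_p <= r.
Proof. by move=> xr yr; rewrite (le_trans (padic_absD x y))// ge_max xr yr. Qed.

Lemma padic_absB_le x y (r : R) : `|x|_p <= r -> `|y|_p <= r -> `|x - y|_p <= r.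
Proof. by move=> xr yr; rewrite padic_absD_le ?padic_absN. Qed.

Lemma padic_abs_subr x y (r : R) : `|y|_p <= r -> (`|x - y|_p <= r) = (`|x|_p <= r).
Proof.
move=> yr; apply/idP/idP => xr; last exact: padic_absB_le.
by rewrite -(subrK y x) padic_absD_le.
Qed.

Lemma padic_abs_addr x y (r : R) : `|y|_p <= r -> (`|x + y|_p <= r) = (`|x|_p <= r).
Proof. by move=> yr; rewrite -[y]opprK padic_abs_subr ?padic_absN. Qed.

(** All triangles are isosceles: the value is locally constant away from 0. *)
Lemma padic_abs_lt_eq x y : `|x - y|_p < `|x|_p -> `|y|_p = `|x|_p.
Proof.
move=> h; apply/eqP; rewrite eq_le; apply/andP; split.
  by rewrite -(padic_abs_subr _ (lexx `|x|_p)) padic_absB ltW.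
have := padic_absD (x - y) y; rewrite subrK le_max => /orP[|//].
by rewrite leNgt h.
Qed.

Lemma padic_abs_int (m : int) : `|m%:~R : Qp|_p = qabs R p m%:~R.
Proof. by rewrite -padic_abs_ratr ratr_int. Qed.

Lemma padic_abs1 : `|1 : Qp|_p = 1.
Proof. by rewrite -[1]/(1%:~R) padic_abs_int qabs1. Qed.

Lemma padic_absp : `|p%:R : Qp|_p = p%:R^-1.
Proof.
rewrite pmulrn padic_abs_int (qabs_int R p_pr).
  by rewrite absz_nat logn_prime// eqxx expr1.
by rewrite eqz_nat -lt0n prime_gt0.
Qed.

Lemma padic_p_neq0 : p%:R != 0 :> Qp.
Proof.
apply/eqP => /padic_abs_eq0; rewrite padic_absp => /eqP.
by rewrite invr_eq0 gt_eqF ?p_gt0.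
Qed.

Lemma padic_absV x : `|x^-1|_p = `|x|_p^-1.
Proof.
have [->|x0] := eqVneq x 0; first by rewrite invr0 padic_abs0 invr0.
have nx : `|x|_p != 0 by apply: contra x0 => /eqP/padic_abs_eq0 ->.
by apply: (mulfI nx); rewrite -padic_absM !mulfV// padic_abs1.
Qed.

Lemma padic_absX x (k : int) : `|x ^ k|_p = `|x|_p ^ k.
Proof.
have nat_case (n : nat) : `|x ^+ n|_p = `|x|_p ^+ n.
  elim: n => [|n ih]; first by rewrite !expr0 padic_abs1.
  by rewrite !exprS padic_absM ih.
by case: k => n; [exact: nat_case|rewrite /exprz padic_absV nat_case].
Qed.

Lemma padic_abs_pX (k : int) : `|p%:R ^ k : Qp|_p = p%:R ^ (- k).
Proof. by rewrite padic_absX padic_absp exprz_inv. Qed.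

(** A rational whose denominator is a power of p and which is a p-adic integer
    is an integer. *)
Lemma qabs_le1_int (q : rat) : (exists k, q * p%:R ^+ k \is a Num.int) ->
  qabs R p q <= 1 -> q \is a Num.int.
Proof.
move=> [k /intrP[m mE]] q1.
have pk0 : (p%:R ^+ k : rat) != 0 by rewrite expf_neq0// pnatr_eq0 -lt0n prime_gt0.
have pkE : (p%:R ^+ k : rat) = (p ^ k)%N%:Z%:~R by rewrite -natrX.
have : qabs R p m%:~R <= p%:R ^- k.
  rewrite -mE qabsM// pkE (qabs_int R p_pr); last first.
    by rewrite eqz_nat -lt0n expn_gt0 prime_gt0.
  by rewrite absz_nat pfactorK// ler_piMl// invr_ge0 exprn_ge0// ltW// p_gt0.
rewrite qabs_int_le// => pm.
have /dvdzP[z mz] : ((p ^ k)%N%:Z %| m)%Z by rewrite dvdzE.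
apply/intrP; exists z; apply: (mulIf pk0); rewrite mE mz rmorphM/=.
by rewrite pkE.
Qed.

Lemma padic_ratrMn (q : rat) n : ratr (q *+ n) = ratr q *+ n :> Qp.
Proof.
pose aM := GRing.isZmodMorphism.Build rat Qp ratr (@padic_ratrB R p p_pr).
pose f : {additive rat -> Qp} := HB.pack (ratr : rat -> Qp) aM.
exact: (raddfMn f).
Qed.

Lemma padic_ratrN (q : rat) : ratr (- q) = - ratr q :> Qp.
Proof.
by rewrite -[- q]sub0r padic_ratrB -[in ratr 0](mulr0z (1 : rat)) ratr_int sub0r.
Qed.

Lemma padic_abs_gt0 x : x != 0 -> 0 < `|x|_p.
Proof.
by move=> x0; rewrite lt_neqAle padic_abs_ge0 andbT eq_sym; apply: contra x0 => /eqP/padic_abs_eq0 ->.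
Qed.

(** The residue field of Z_p has the representatives 0, ..., p - 1; the
    representative of x is p times the fractional part of x / p. *)
Lemma padic_residue x : `|x|_p <= 1 ->
  exists j : 'I_p, `|x - (j : nat)%:R|_p <= p%:R^-1.
Proof.
move=> x1; have p0 := padic_p_neq0; have pp : (0 : rat) < p%:R by rewrite ltr0n prime_gt0.
have [/andP[q0 q1] [k qk] xq] := padic_fracP (x / p%:R).
set q := padic_frac _ in q0 q1 qk xq.
have xpq : `|x - ratr (q *+ p)|_p <= p%:R^-1.
  rewrite padic_ratrMn -[ratr q *+ p]mulr_natr -{1}[x](divfK p0) -mulrBl.
  by rewrite padic_absM padic_absp ler_piMl// invr_ge0 ltW ?p_gt0.
have : q *+ p \is a Num.int.
  apply: qabs_le1_int; first by exists k; rewrite mulrnAl rpredMn.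
  rewrite -padic_abs_ratr -(padic_abs_subr _ x1) padic_absB (le_trans xpq)//.
  by rewrite invf_le1 ?p_gt0// ltW// p_gt1.
move=> /intrP[m mE].
have m0 : 0 <= m by rewrite -(ler0z rat) -mE mulrn_wge0.
have mp : m < p%:Z.
  by rewrite -(ltr_int rat) -mE -pmulrn -[q *+ p]mulr_natr -[ltRHS]mul1r ltr_pM2r.
case: m m0 mp mE => // j _ jp mE.
by exists (Ordinal jp); move: xpq; rewrite mE ratr_int -pmulrn.
Qed.

Lemma padic_residue_uniq (i j : 'I_p) :
  `|(i : nat)%:R - (j : nat)%:R : Qp|_p <= p%:R^-1 -> i = j.
Proof.
rewrite !pmulrn -rmorphB padic_abs_int.
have := qabs_int_le R p_pr (i%:Z - j%:Z) 1; rewrite expr1 expn1 => -> pij.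
apply/val_inj => /=; have := ltn_ord i; have := ltn_ord j.
case: (eqVneq `|i%:Z - j%:Z|%N 0%N) => [|ij0]; first lia.
by have := dvdn_leq _ pij; lia.
Qed.

Lemma padic_nat_le1 n : `|n%:R : Qp|_p <= 1.
Proof.
elim: n => [|n ih]; first by rewrite padic_abs0.
by rewrite -natr1 padic_absD_le// padic_abs1.
Qed.

(** Rescaled residues: the ball of radius p^(k+1) is covered by p balls of
    radius p^k, which are disjoint by [padic_digit_uniq]. *)
Lemma padic_digit (k : int) x : `|x|_p <= p%:R ^ (k + 1) ->
  exists j : 'I_p, `|x - (j : nat)%:R * p%:R ^ (- k - 1)|_p <= p%:R ^ k.
Proof.
have p0 := padic_p_neq0; have pR0 := p_gt0.
have pR0' : p%:R != 0 :> R by rewrite gt_eqF.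
move=> xk; have [|j jx] := @padic_residue (x * p%:R ^ (k + 1)).
  by rewrite padic_absM padic_abs_pX -invr_expz ler_pdivrMr ?exprz_gt0// mul1r.
exists j.
have PQ : p%:R ^ (k + 1) * p%:R ^ (- k - 1) = 1 :> Qp.
  by rewrite -expfzDr// (_ : k + 1 + _ = 0) ?expr0z//; lia.
have -> : x - (j : nat)%:R * p%:R ^ (- k - 1) =
    (x * p%:R ^ (k + 1) - (j : nat)%:R) * p%:R ^ (- k - 1).
  by rewrite mulrBl -mulrA PQ mulr1.
rewrite padic_absM padic_abs_pX.
rewrite -ler_pdivlMr ?exprz_gt0// (le_trans jx)// invr_expz -expfzDr//.
by rewrite -[p%:R^-1]/(p%:R ^ (-1)) (_ : k + _ = -1); [exact: lexx|lia].
Qed.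

Lemma padic_digit_uniq (k : int) (i j : 'I_p) :
  `|((i : nat)%:R - (j : nat)%:R) * p%:R ^ (- k - 1) : Qp|_p <= p%:R ^ k -> i = j.
Proof.
have pR0 := p_gt0; have pR0' : p%:R != 0 :> R by rewrite gt_eqF.
move=> h; apply: padic_residue_uniq; move: h.
rewrite padic_absM padic_abs_pX -ler_pdivlMr ?exprz_gt0// invr_expz -expfzDr//.
by rewrite (_ : k + _ = -1)//; lia.
Qed.

(** The value group is discrete: no value lies strictly between 1 and p. The
    point is decided by whether the digit of x at p^(-1) vanishes. *)
Lemma padic_abs_p_dichotomy x : `|x|_p <= p%:R -> `|x|_p <= 1 \/ `|x|_p = p%:R.
Proof.
move=> xp; have [|j] := @padic_digit 0 x; first by rewrite add0r expr1z.
rewrite expr0z => jx; have [j0|j0] := eqVneq (j : nat) 0%N.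
  by left; move: jx; rewrite j0 mul0r subr0.
right; have ja : `|(j : nat)%:R * p%:R ^ (- 0 - 1) : Qp|_p = p%:R.
  rewrite padic_absM padic_abs_pX pmulrn padic_abs_int qabs_int//.
  have -> : logn p `|j%:Z| = 0%N.
    by rewrite absz_nat lognE gtnNdvd ?lt0n// !andbF.
  by rewrite expr0 invr1 mul1r oppr0 sub0r opprK expr1z.
rewrite -ja; apply: padic_abs_lt_eq; rewrite ja padic_absB.
by rewrite (le_lt_trans jx)// p_gt1.
Qed.

Lemma padic_frac_uniqE x q : is_padic_frac x q -> padic_frac x = q.
Proof. exact: padic_frac_uniq (padic_fracP x). Qed.

Lemma padic_frac_addr x y : `|y|_p <= 1 -> padic_frac (x + y) = padic_frac x.
Proof.
move=> y1; apply: padic_frac_uniqE; have [? ? ?] := padic_fracP x.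
by split=> //; rewrite addrAC padic_absD_le.
Qed.

Lemma padic_frac_eq0 x : (padic_frac x == 0) = (`|x|_p <= 1).
Proof.
have [_ _ xq] := padic_fracP x; apply/eqP/idP => [q0|x1].
  by move: xq; rewrite q0 -[0]/(0%:~R) ratr_int subr0.
apply: padic_frac_uniqE; split; first by rewrite lexx ltr01.
- by exists 0%N; rewrite mul0r.
- by rewrite -[0]/(0%:~R) ratr_int subr0.
Qed.

End padic_theory.

(** * The real part of the additive character *)

Section characters.
Context {R : realType} {p : nat} {p_pr : prime p}.
Local Notation Qp := (padic R p_pr).
Local Notation "`| x |_p" := (padic_abs x) (format "`| x |_p").
Implicit Types x y z w : Qp.

Definition padic_cos w : R := complex.Re (padic_char w).

Lemma cosDint (a : R) (m : int) : cos (a + 2 * pi * m%:~R) = cos a.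
Proof.
have h (n : nat) (c : R) : cos (c + 2 * pi * n%:R) = cos c.
  by rewrite mulr_natl mulr_natr (periodicn (@cosD2pi R)).
case: m => n; first exact: h.
by rewrite NegzE rmorphN mulrN -[in RHS](subrK (2 * pi * n.+1%:R) a) h.
Qed.

Lemma cosD_cosB (a c : R) : cos (a + c) + cos (a - c) = 2 * cos c * cos a.
Proof. by rewrite cosD cosB; ring. Qed.

(** Any rational approximation of x modulo Z_p with denominator a power of p
    can replace the fractional part, since the two differ by an integer. *)
Lemma padic_cosE x (q : rat) : (exists k, q * p%:R ^+ k \is a Num.int) ->
  `|x - ratr q|_p <= 1 -> padic_cos x = cos (2 * pi * ratr q).
Proof.
move=> [k qk] xq; have [_ [l rl] xr] := padic_fracP x.
have /intrP[m mE] : q - padic_frac x \is a Num.int.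
  apply: (@qabs_le1_int R p p_pr).
    exists (k + l)%N; rewrite mulrBl {1}exprD mulrA addnC exprD mulrA.
    by apply: rpredB; apply: rpredM => //; apply: rpredX; exact: rpred_nat.
  rewrite -(padic_abs_ratr R p_pr) padic_ratrB.
  have -> : ratr q - ratr (padic_frac x) = (x - ratr (padic_frac x)) - (x - ratr q) :> Qp.
    by rewrite opprB [RHS]addrC subrKA.
  exact: padic_absB_le.
have -> : q = padic_frac x + m%:~R by rewrite -mE addrC subrK.
by rewrite rmorphD/= ratr_int mulrDr cosDint.
Qed.

(** The identity cos(a + c) + cos(a - c) = 2 cos a cos c, transported through
    fractional parts, which are additive modulo integers. *)
Lemma padic_cosD x z :
  padic_cos (x + z) + padic_cos (x - z) = 2 * padic_cos z * padic_cos x.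
Proof.
have [_ [k qk] xq] := padic_fracP x; have [_ [l rl] zr] := padic_fracP z.
have int_frac : forall e : bool,
   exists k, (padic_frac x + (-1) ^+ e * padic_frac z) * p%:R ^+ k \is a Num.int.
  move=> e; exists (k + l)%N.
  have -> : (padic_frac x + (-1) ^+ e * padic_frac z) * p%:R ^+ (k + l) =
      padic_frac x * p%:R ^+ k * p%:R ^+ l +
      (-1) ^+ e * (padic_frac z * p%:R ^+ l * p%:R ^+ k) by rewrite exprD; ring.
  have intX n : (p%:R : rat) ^+ n \is a Num.int by rewrite rpredX// rpred_nat.
  apply: rpredD; first exact: rpredM.
  by apply: rpredM; [rewrite rpredX// rpredN rpred1|exact: rpredM].
rewrite (@padic_cosE (x + z) _ (int_frac false)) ?(@padic_cosE (x - z) _ (int_frac true)).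
- rewrite expr0 expr1 mul1r mulN1r rmorphD rmorphB/= mulrDr mulrBr.
  exact: cosD_cosB.
- rewrite expr1 mulN1r padic_ratrB.
  have -> : x - z - (ratr (padic_frac x) - ratr (padic_frac z)) =
    (x - ratr (padic_frac x)) - (z - ratr (padic_frac z)) by rewrite !opprD !opprK addrACA.
  exact: padic_absB_le.
- rewrite expr0 mul1r -[padic_frac z]opprK padic_ratrB padic_ratrN.
  have -> : x + z - (ratr (padic_frac x) - - ratr (padic_frac z)) =
    (x - ratr (padic_frac x)) + (z - ratr (padic_frac z)) by rewrite opprK opprD addrACA.
  exact: padic_absD_le.
Qed.

Lemma padic_cos_addr x y : `|y|_p <= 1 -> padic_cos (x + y) = padic_cos x.
Proof. by move=> y1; rewrite /padic_cos /padic_char/= padic_frac_addr. Qed.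

Lemma padic_cos_eq1 w : `|w|_p <= 1 -> padic_cos w = 1.
Proof.
rewrite -padic_frac_eq0 => /eqP w0.
by rewrite /padic_cos /padic_char/= w0 rmorph0 mulr0 cos0.
Qed.

(** The fractional part q of w lies strictly between 0 and 1, and
    1 - cos(2 pi q) = 2 sin(pi q)^2. *)
Lemma padic_cos_neq1 w : 1 < `|w|_p -> padic_cos w != 1.
Proof.
rewrite ltNge -padic_frac_eq0 => w0; rewrite /padic_cos /padic_char/=.
have [/andP[q0 q1] _ _] := padic_fracP w.
set q := padic_frac w in w0 q0 q1 *.
have qR0 : (0 : R) < ratr q by rewrite ltr0q lt_neqAle eq_sym w0.
have qR1 : ratr q < 1 :> R by rewrite -(rmorph1 (@ratr R)) ltr_rat.
have -> : 2 * pi * ratr q = (pi * ratr q) *+ 2 :> R by ring.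
have s0 : 0 < sin (pi * ratr q : R).
  by apply: sin_gt0_pi; rewrite mulr_gt0 ?pi_gt0//= gtr_pMr ?pi_gt0.
rewrite cos_mulr2n; have := cos2Dsin2 (pi * ratr q : R) => cs.
have : 0 < sin (pi * ratr q : R) ^+ 2 by rewrite exprn_gt0.
by move=> s20; rewrite lt_eqF//; lra.
Qed.

Lemma padic_cos_abs_le1 w : `|padic_cos w| <= 1.
Proof. by rewrite ler_norml cos_geN1 cos_le1. Qed.

End characters.

(** * Boxes in Q_p^d and the Borel sigma-algebra *)

Section boxes.
Context {R : realType} {p : nat} {p_pr : prime p} {d : nat}.
Local Notation Qp := (padic R p_pr).
Local Notation V := 'rV[Qp]_d.
Local Notation BV := (borel V).
Local Notation "`| x |_p" := (padic_abs x) (format "`| x |_p").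
Implicit Types (x y z : V) (n : 'I_d -> int).

Definition box n : set V := [set y | forall i, `|y 0 i|_p <= p%:R ^ n i].

Lemma box_addr n x y : box n y -> box n (x + y) <-> box n x.
Proof.
move=> ny; split=> h i; have := h i; have := ny i; rewrite ?mxE => yi xi.
  by rewrite -(padic_abs_addr _ yi).
by rewrite padic_abs_addr.
Qed.

Lemma box_opp n y : box n (- y) <-> box n y.
Proof. by split=> h i; have := h i; rewrite mxE padic_absN. Qed.

Lemma box_subr n x y : box n y -> box n (x - y) <-> box n x.
Proof. by move=> yn; exact: (@box_addr n x (- y) ((box_opp n y).2 yn)). Qed.

Lemma box_subC n x y : box n (x - y) <-> box n (y - x).
Proof. by rewrite -opprB; exact: box_opp. Qed.

Lemma box_trans n x y z : box n (x - y) -> box n (y - z) -> box n (x - z).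
Proof. by move=> xy yz; have := (box_addr (x - y) yz).2 xy; rewrite subrKA. Qed.

Lemma padic_ballE (u v : Qp) (e : R) : ball u e v <-> `|v - u|_p < e.
Proof.
have E : mdist u v = `|v - u|_p by rewrite padic_absB.
by rewrite ballEmdist/= E.
Qed.

Lemma rV_ballE x (e : R) y : ball x e y <-> 0 < e /\ forall i, `|y 0 i - x 0 i|_p < e.
Proof.
split=> [[e0 h]|[e0 h]].
  by split=> // i; have := h 0 i; move/padic_ballE.
by split=> // i j; rewrite (ord1 i); apply/padic_ballE; exact: h.
Qed.

(** Boxes are neighbourhoods of 0: a ball of radius at most each p^(n i) fits. *)
Lemma box_nbhs n : exists2 e : R, 0 < e & forall x y, ball x e y -> box n (y - x).
Proof.
exists (\big[Num.min/1]_i (p%:R ^ n i)).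
  by apply: lt_bigmin => // i _; rewrite exprz_gt0// p_gt0.
move=> x y /rV_ballE[_ h] i; rewrite !mxE ltW// (lt_le_trans (h i))//.
exact: bigmin_le.
Qed.

Lemma rV_open_ball (A : set V) x : open A -> A x ->
  exists2 e : R, 0 < e & ball x e `<=` A.
Proof. by move=> oA Ax; have /nbhs_ballP := open_nbhs_nbhs (conj oA Ax). Qed.

Lemma rV_ball_open (A : set V) :
  (forall x, A x -> exists2 e : R, 0 < e & ball x e `<=` A) -> open A.
Proof. by move=> hA; rewrite openE => x /hA xA; apply/nbhs_ballP. Qed.

(** Openness only has to be tested against boxes, so every box, being a group,
    is open, and so are all sets invariant under translation by a box. *)
Lemma locally_box_open (A : set V) :
  (forall x, A x -> exists n, forall u, box n u -> A (x + u)) -> open A.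
Proof.
move=> hA; apply: rV_ball_open => x /hA[n xn].
have [e e0 he] := box_nbhs n; exists e => // y /he /xn.
by rewrite addrC subrK.
Qed.

Lemma open_measurable_borel (A : set V) : open A -> measurable (A : set BV).
Proof. by move=> oA; apply: sub_sigma_algebra. Qed.

Lemma measurable_box n x : measurable ([set y | box n (y - x)] : set BV).
Proof.
apply: open_measurable_borel; apply: locally_box_open => y yx; exists n => u nu.
by rewrite /= addrAC; apply/(box_addr _ nu).
Qed.

Lemma measurable_box0 n : measurable (box n : set BV).
Proof. by have := measurable_box n 0; under eq_fun do rewrite subr0. Qed.

Lemma locally_constant_measurable (f : V -> R) :
  (forall x, exists n, forall u, box n u -> f (x + u) = f x) ->
  measurable_fun setT (f : BV -> R).
Proof.
move=> hf _ Y _; rewrite setTI; apply: open_measurable_borel; apply: locally_box_open.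
by move=> x /= fx; have [n xn] := hf x; exists n => u /xn /= ->.
Qed.

Lemma measurable_max_norm : measurable_fun setT (@max_norm R p p_pr d : BV -> R).
Proof.
apply: (measurability _ (measurable_realfun.RGenInftyO.measurableE R)) => //.
move=> _ [_ [r ->] <-]; rewrite setTI; apply: open_measurable_borel.
apply: rV_ball_open => x /=; rewrite in_itv/= => xr.
have r0 : 0 < r by rewrite (le_lt_trans _ xr)// /max_norm bigmax_idl le_max lexx.
exists r => // y /rV_ballE[_ h] /=; rewrite in_itv/= /max_norm bigmax_lt// => i _.
rewrite -(subrK (x 0 i) (y 0 i)) (le_lt_trans (padic_absD _ _))// gt_max h/=.
by rewrite (le_lt_trans _ xr)// /max_norm le_bigmax.
Qed.

(** Countability enters through rational points: every box has countably many
    cosets. *)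
Lemma rat_dense n x : exists q : 'rV[rat]_d, box n (x - map_mx ratr q).
Proof.
have h i : exists q : rat, `|x 0 i - ratr q|_p < p%:R ^ n i.
  by apply: padic_dense; rewrite exprz_gt0// p_gt0.
exists (\row_i xget 0 [set q | `|x 0 i - ratr q|_p < p%:R ^ n i]) => i.
by rewrite !mxE ltW//; exact: (xgetPex 0 (h i)).
Qed.

Lemma dot_addl x y z : dot (x + y) z = dot x z + dot y z.
Proof.
by rewrite /dot -big_split; apply: eq_bigr => i _; rewrite mxE mulrDl.
Qed.

Lemma dot_addr x y z : dot x (y + z) = dot x y + dot x z.
Proof.
by rewrite /dot -big_split; apply: eq_bigr => i _; rewrite mxE mulrDr.
Qed.

Lemma dot_opp x z : dot (- x) z = - dot x z.
Proof.
by rewrite /dot -sumrN; apply: eq_bigr => i _; rewrite mxE mulNr.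
Qed.

Lemma dotC x y : dot x y = dot y x.
Proof. by apply: eq_bigr => i _; rewrite mulrC. Qed.

Lemma dot_le n x y : box n x -> box (fun i => - n i) y -> `|dot x y|_p <= 1.
Proof.
move=> nx ny; rewrite /dot; apply: (big_ind (fun w : Qp => `|w|_p <= 1)) => [|u v|i _].
- by rewrite padic_abs0.
- exact: padic_absD_le.
- rewrite padic_absM -[leRHS](_ : p%:R ^ n i * p%:R ^ (- n i) = 1).
    by rewrite ler_pM// padic_abs_ge0.
  by rewrite -expfzDr ?subrr ?expr0z// gt_eqF ?p_gt0.
Qed.

Lemma box_exhaust y : exists N : nat, box (fun=> N%:Z) y.
Proof.
have [N hN] : exists N : nat, \sum_i `|y 0 i|_p <= N%:R.
  by exists (Num.truncn (\sum_i `|y 0 i|_p)).+1; rewrite ltW// truncnS_gt.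
exists N => i; rewrite -exprnP (@le_trans _ _ N%:R)//.
  rewrite (le_trans _ hN)// (bigD1 i)//= lerDl sumr_ge0// => j _.
  exact: padic_abs_ge0.
by rewrite -natrX ler_nat ltnW// ltn_expl// prime_gt1.
Qed.

(** A point outside the dual box is detected by a multiple of a basis vector,
    so the dual box is exactly the annihilator of the box. *)
Lemma box_perp n y : ~ box (fun i => - n i) y -> exists2 z, box n z & 1 < `|dot z y|_p.
Proof.
move=> /existsNP[i /negP]; rewrite -ltNge => yi.
exists (\row_j (if j == i then p%:R ^ (- n i) else 0)).
  move=> j; rewrite mxE; case: eqP => [->|_].
    by rewrite padic_abs_pX opprK.
  by rewrite padic_abs0 exprz_ge0.
rewrite /dot (bigD1 i)//= big1 ?addr0 => [|j ji].
  rewrite mxE eqxx padic_absM padic_abs_pX opprK.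
  by rewrite -ltr_pdivrMl ?exprz_gt0 ?p_gt0// mulr1 invr_expz.
by rewrite mxE (negPf ji) mul0r.
Qed.
End boxes.

(** * Haar measure of boxes *)

Section haar_boxes.
Context {R : realType} {p : nat} {p_pr : prime p} {d : nat}.
Local Notation Qp := (padic R p_pr).
Local Notation V := 'rV[Qp]_d.
Local Notation BV := (borel V).
Local Notation "`| x |_p" := (padic_abs x) (format "`| x |_p").
Implicit Types (x y z : V) (n : 'I_d -> int).
Variable mu : {measure set BV -> \bar R}.
Hypothesis mu_haar : normalized_haar mu.

Lemma haar_translate (A : set BV) (a : V) : measurable A ->
  mu [set y : V | A (y - a)] = mu A.
Proof.
move=> mA; rewrite -(haar_shift mu_haar a mA); congr (mu _).
apply/seteqP; split=> [y Ay|_ [x Ax <-]] /=; first by exists (y - a) => //; rewrite addrC subrK.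
by rewrite [a + x]addrC addrK.
Qed.

Lemma haar_box_unit : mu (box (fun=> 0)) = 1%E.
Proof.
by rewrite -(haar_unit mu_haar); congr (mu _).
Qed.

Definition incr n (i : 'I_d) : 'I_d -> int := fun j => n j + (j == i)%:Z.

(** Enlarging one radius by a factor p gives a disjoint union of p translates,
    indexed by a p-adic digit of the coordinate. *)
Lemma haar_box_incr n i : mu (box (incr n i)) = (p%:R%:E * mu (box n))%E.
Proof.
pose c (j : 'I_p) : V := \row_k (if k == i then (j : nat)%:R * p%:R ^ (- n i - 1) else 0).
pose F (j : 'I_p) : set BV := [set y : V | box n (y - c j)].
have nE k : k != i -> incr n i k = n k by move=> ki; rewrite /incr (negPf ki) addr0.
have iE : incr n i i = n i + 1 by rewrite /incr eqxx.
have -> : box (incr n i) = \big[setU/set0]_(j < p) F j.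
  rewrite -bigcup_seq; apply/seteqP; split=> [y yn|y [j _ Fy] k].
    have := yn i; rewrite iE => /padic_digit[j jy]; exists j; first by rewrite /= mem_index_enum.
    move=> k.
    rewrite !mxE; have [->//|ki] := eqVneq k i.
    by rewrite subr0; have := yn k; rewrite nE.
  have := Fy k; rewrite !mxE; have [->|ki] := eqVneq k i; last by rewrite subr0 nE.
  rewrite iE => jy; rewrite -(subrK ((j : nat)%:R * p%:R ^ (- n i - 1)) (y 0 i)).
  apply: padic_absD_le.
    by rewrite (le_trans jy)// ler_weXz2l ?lerDl// ltW// p_gt1.
  rewrite padic_absM padic_abs_pX -[leRHS]mul1r ler_pM ?padic_abs_ge0 ?exprz_ge0 ?padic_nat_le1//.
  by rewrite (_ : - _ = n i + 1)//; lia.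
rewrite (measure_bigsetU_ord mu xpredT).
- rewrite (eq_bigr (fun=> mu (box n))) => [|j _]; last exact: (haar_translate (c j) (measurable_box0 n)).
  by rewrite sumr_const card_ord mule_natl.
- by move=> j; exact: measurable_box.
- move=> j k _ _ [y [jy ky]]; apply: (@padic_digit_uniq R p p_pr (n i)).
  have : box n (c j - c k).
    have -> : c j - c k = (y - c k) - (y - c j) by rewrite opprB [RHS]addrC subrKA.
    exact: (box_subr _ jy).2.
  by move=> /(_ i); rewrite !mxE eqxx -mulrBl.
Qed.

(** Induction on the distance of n to 0, one step of [haar_box_incr] at a time,
    upwards or downwards. *)
Lemma haar_box n : mu (box n) = (p%:R ^ (\sum_i n i))%:E.
Proof.
have pR0 : p%:R != 0 :> R by rewrite gt_eqF// p_gt0.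
have [m] := ubnP (\sum_i `|n i|%N)%N; elim: m n => // m ih n nm.
have [n0|] := eqVneq (\sum_i `|n i|%N)%N 0%N.
  have n0i i : n i = 0.
    by apply/eqP; rewrite -absz_eq0; move/eqP: n0; rewrite sum_nat_eq0 => /forallP/(_ i).
  have -> : n = fun=> 0 by apply/funext.
  by rewrite haar_box_unit big1// expr0z.
move=> nN0; have [i ni0] : exists i, n i != 0.
  apply: contrapT => /forallNP h; move/eqP: nN0; apply; rewrite big1// => i _.
  by have /negP := h i; rewrite negbK => /eqP ->.
have dist_incr k : (incr k i i = k i + 1) /\ \sum_j incr k i j = (\sum_j k j) + 1.
  split; first by rewrite /incr eqxx.
  rewrite /incr big_split/=; congr (_ + _).
  by rewrite (bigD1 i)//= eqxx big1 ?addr0// => j /negPf ->.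
case: (ltP 0 (n i)) => [ni|ni].
  pose k : 'I_d -> int := fun j => n j - (j == i)%:Z.
  have nk : n = incr k i by apply/funext => j; rewrite /incr subrK.
  have km : (\sum_i `|k i| < m)%N.
    rewrite -ltnS; apply: leq_trans nm; rewrite ltnS (bigD1 i)//= [ltnRHS](bigD1 i)//=.
    rewrite (eq_bigr (fun j => `|n j|%N)) => [|j /negPf ji]; last by rewrite /k ji subr0.
    by rewrite ltn_add2r /k eqxx; lia.
  rewrite {1}nk haar_box_incr (ih _ km) -EFinM nk (dist_incr k).2.
  by rewrite [in RHS]addrC expfzDr// expr1z.
have km : (\sum_j `|incr n i j| < m)%N.
  rewrite -ltnS; apply: leq_trans nm; rewrite ltnS (bigD1 i)//= [ltnRHS](bigD1 i)//=.
  rewrite (eq_bigr (fun j => `|n j|%N)) => [|j /negPf ji]; last by rewrite /incr ji addr0.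
  by rewrite ltn_add2r /incr eqxx; lia.
have := haar_box_incr n i; rewrite (ih _ km) (dist_incr n).2 addrC expfzDr// expr1z EFinM.
move=> /(congr1 (fun u => ((p%:R^-1)%:E * u)%E)); rewrite !muleA -!EFinM mulVf// !mul1e.
by rewrite mul1r => <-.
Qed.

Lemma haar_sigma_finite : sigma_finite [set: BV] mu.
Proof.
exists (fun N => box (fun=> N%:Z)).
  by apply/seteqP; split=> // y _; have [N yN] := box_exhaust y; exists N.
by move=> N; rewrite haar_box ltry; split=> //; exact: measurable_box0.
Qed.

End haar_boxes.

(** * Integrability of exp(- a ||y||^b) *)

Section radial_kernel.
Context {R : realType} {p : nat} {p_pr : prime p} {d : nat}.
Local Notation Qp := (padic R p_pr).
Local Notation V := 'rV[Qp]_d.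
Local Notation BV := (borel V).
Variables (a b : R).
Hypotheses (a_gt0 : 0 < a) (b_gt0 : 0 < b).
Variable mu : {measure set BV -> \bar R}.
Hypothesis mu_haar : normalized_haar mu.

(** For a = sigma t this is the characteristic function of X_t. *)
Definition radial (y : V) : R := expR (- (a * max_norm y `^ b)).

Lemma measurable_radial : measurable_fun setT (radial : BV -> R).
Proof.
apply: measurableT_comp => //; apply: measurable_funN.
apply: measurable_funM => //.
apply: (measurableT_comp (measurable_powR b)).
exact: measurable_max_norm.
Qed.

(** From s^m / m! <= exp s with s = a r^b and m > k / b. *)
Lemma expR_powR_decay (k : nat) : exists2 C : R, 0 <= C &
  forall r, 1 <= r -> expR (- (a * r `^ b)) <= C * r ^- k.
Proof.
set m := Num.truncn (k%:R / b); exists (m.+1`!%:R / a ^+ m.+1).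
  by rewrite divr_ge0// exprn_ge0// ltW.
move=> r r1; have r0 : 0 < r by rewrite (lt_le_trans _ r1).
set s := a * r `^ b; have s0 : 0 < s by rewrite mulr_gt0// powR_gt0.
have h : s ^+ m.+1 / m.+1`!%:R <= expR s.
  by rewrite (le_trans _ (expR_ge1Dxn m (ltW s0)))// lerDr.
have rk : r ^+ k <= (r `^ b) ^+ m.+1.
  rewrite -!powR_mulrn ?powR_ge0 ?(ltW r0)// -powRrM ler_powR//.
  by rewrite mulrC -ler_pdivrMr// ltW// truncnS_gt.
rewrite expRN -[leRHS]invrK lef_pV2 ?posrE ?expR_gt0 ?invr_gt0 ?mulr_gt0 ?invr_gt0 ?exprn_gt0 ?ltr0n ?fact_gt0//.
rewrite (le_trans _ h)// !invfM !invrK -mulrA mulrC ler_wpM2r ?invr_ge0//.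
by rewrite /s exprMn ler_wpM2l// exprn_ge0// ltW.
Qed.

Lemma radial_ge0 y : 0 <= radial y.
Proof. exact: expR_ge0. Qed.

Lemma measurable_radialE : measurable_fun setT (fun y : BV => (radial y)%:E).
Proof. by apply/measurable_EFinP; exact: measurable_radial. Qed.

Lemma not_box_norm (M : nat) (y : V) : ~ box (fun=> M%:Z) y -> p%:R ^+ M < max_norm y.
Proof.
move=> /existsNP[i /negP]; rewrite -ltNge => yi.
by rewrite (lt_le_trans yi)// /max_norm le_bigmax.
Qed.

(** Split the space into the shells between consecutive balls of radius p^N.
    On the shell of index N the integrand is at most K p^(- N (d + 1)) and the
    measure at most p^(N d), so the series of shells is dominated by a
    geometric series of ratio 1 / p <= 1 / 2. *)
Lemma integral_radial_lty : (\int[mu]_y (radial y)%:E < +oo)%E.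
Proof.
have p0 := @p_gt0 R p p_pr; have p1 := @p_gt1 R p p_pr.
pose B N : set BV := box (fun=> N%:Z).
have mB N : measurable (B N) by exact: measurable_box0.
have mD N : measurable (seqDU B N).
  by apply: measurableD => //; exact: bigsetU_measurable.
have BT : [set: BV] = \bigcup_N seqDU B N.
  rewrite -seqDU_bigcup_eq; apply/seteqP; split=> // y _.
  by have [N yN] := box_exhaust y; exists N.
have [C C0 hC] := expR_powR_decay d.+1.
(* 1 bounds the integrand on the unit ball; the factor p^(d+1) accounts for
   the inner radius p^(N-1) of the shell of index N. *)
pose K : R := 1 + C * p%:R ^+ d.+1.
have K0 : 0 <= K by rewrite addr_ge0// mulr_ge0// exprn_ge0// ltW.
have radial_le N y : seqDU B N y -> radial y <= K * p%:R ^- (N * d.+1).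
  case: N => [_|M [_ yM]].
    rewrite mul0n expr0 invr1 mulr1 (@le_trans _ _ 1)//.
      by rewrite -expR0 ler_expR oppr_le0 mulr_ge0 ?powR_ge0 ?ltW.
    by rewrite lerDl mulr_ge0// exprn_ge0// ltW.
  have {}yM : p%:R ^+ M < max_norm y.
    by apply: not_box_norm => yBM; apply: yM; rewrite -bigcup_mkord; exists M => /=.
  have M1 : 1 <= p%:R ^+ M :> R by rewrite exprn_ege1// ltW.
  have y1 : 1 <= max_norm y by rewrite (le_trans M1)// ltW.
  rewrite (le_trans (hC _ y1))// (@le_trans _ _ (C * p%:R ^- (M * d.+1)))//.
    rewrite ler_wpM2l// lef_pV2 ?posrE ?exprn_gt0 ?(lt_le_trans _ y1)//.
    by rewrite exprM lerXn2r ?nnegrE ?exprn_ge0 ?(ltW yM) ?(le_trans _ y1) ?(ltW p0).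
  rewrite mulSn exprD invfM mulrA ler_wpM2r ?invr_ge0 ?exprn_ge0 ?(ltW p0)//.
  by rewrite ler_pdivlMr ?exprn_gt0// lerDr.
rewrite BT ge0_integral_bigcup//; last 2 first.
- by apply: measurable_funTS; exact: measurable_radialE.
- by move=> y _; rewrite lee_fin radial_ge0.
apply: (@le_lt_trans _ _ (\sum_(0 <= N <oo) (2 * K / (2 ^ (N + 1))%:R)%:E)%E).
  apply: lee_nneseries => [N _ _|N _].
    by apply: integral_ge0 => y _; rewrite lee_fin radial_ge0.
  apply: (@le_trans _ _ (\int[mu]_(y in seqDU B N) cst (K * p%:R ^- (N * d.+1))%:E y)%E).
    apply: ge0_le_integral => //.
    + by move=> y _; rewrite lee_fin radial_ge0.
    + by apply: measurable_funTS; exact: measurable_radialE.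
    + by move=> y Dy; rewrite lee_fin; exact: radial_le.
  rewrite integral_cst//.
  apply: (@le_trans _ _ ((K * p%:R ^- (N * d.+1))%:E * mu (B N))%E).
    rewrite lee_wpmul2l ?lee_fin ?mulr_ge0 ?invr_ge0 ?exprn_ge0 ?(ltW p0)//.
    by apply: le_measure; rewrite ?inE//; exact: subDsetl.
  rewrite haar_box// sumr_const card_ord -EFinM lee_fin.
  have -> : N%:Z *+ d = (N * d)%N%:Z by rewrite -mulr_natr natz PoszM.
  rewrite -exprnP mulnS exprD invfM mulrA divfK ?expf_neq0 ?gt_eqF//.
  rewrite addn1 expnS natrM -mulrA invfM mulrCA mulVKf//.
  have h2 : (2 ^ N)%:R <= p%:R ^+ N :> R.
    by rewrite -natrX ler_nat; case: (N) => [//|M]; rewrite leq_exp2r// prime_gt1.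
  by rewrite ler_wpM2l// lef_pV2 ?posrE// ?exprn_gt0// ltr0n expn_gt0.
rewrite (cvg_lim _ (@cvg_geometric_eseries_half R (2 * K) 0))//.
by rewrite ltry.
Qed.
End radial_kernel.

(** * Orthogonality of characters on a box *)

Section orthogonality.
Context {R : realType} {p : nat} {p_pr : prime p} {d : nat}.
Local Notation Qp := (padic R p_pr).
Local Notation V := 'rV[Qp]_d.
Local Notation BV := (borel V).
Implicit Types (x y z : V) (n : 'I_d -> int).
Variable mu : {measure set BV -> \bar R}.
Hypothesis mu_haar : normalized_haar mu.

(** The exponents of the dual box, the set of y at which every character
    x |-> chi(x . y) with x in the box is trivial. *)
Definition dual n : 'I_d -> int := fun i => - n i.

Lemma dual_dual n : dual (dual n) = n.
Proof. by apply/funext => i; rewrite /dual opprK. Qed.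

Lemma haar_box_lty n : (mu (box n) < +oo)%E.
Proof. by rewrite haar_box// ltry. Qed.

Lemma cos_dot_addl n x u y : box n u -> box (dual n) y ->
  padic_cos (dot (x + u) y) = padic_cos (dot x y).
Proof. by move=> nu ny; rewrite dot_addl padic_cos_addr// (dot_le nu). Qed.

Lemma cos_dot_addr n x y u : box n x -> box (dual n) u ->
  padic_cos (dot x (y + u)) = padic_cos (dot x y).
Proof. by move=> nx nu; rewrite dot_addr padic_cos_addr// (dot_le nx). Qed.

(** A character is constant on the cosets of a small enough box. *)
Lemma measurable_cos_dot y : measurable_fun setT (fun x : BV => padic_cos (dot x y)).
Proof.
apply: locally_constant_measurable => x; have [N yN] := box_exhaust y.
exists (dual (fun=> N%:Z)) => u nu; apply: (cos_dot_addl _ nu).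
by rewrite dual_dual.
Qed.

Lemma integrable_box_bounded n (f : V -> R) :
  measurable_fun setT (f : BV -> R) -> (forall x, `|f x| <= 1) ->
  mu.-integrable (box n) (EFin \o f).
Proof.
move=> mf f1; apply: measurable_bounded_integrable.
- exact: measurable_box0.
- exact: haar_box_lty.
- exact: measurable_funTS.
- exists 1; split; first exact: num_real.
  by move=> r r1 x _; rewrite /= (le_trans (f1 x))// ltW.
Qed.

Lemma integrable_cos_dot n y :
  mu.-integrable (box n) (EFin \o (fun x => padic_cos (dot x y))).
Proof.
apply: integrable_box_bounded; first exact: measurable_cos_dot.
by move=> x; exact: padic_cos_abs_le1.
Qed.

Lemma measurable_translation z : measurable_fun setT ((fun x : V => x + z) : BV -> BV).
Proof.
apply: (@measurability _ _ BV BV setT _ (@open V)); first by [].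
move=> _ [U oU <-]; rewrite setTI.
apply: open_measurable_borel; apply: rV_ball_open => x Ux.
have oU' : @open V U by exact: oU.
pose y : V := x + z; have Uy : U y by exact: Ux.
have [e e0 he] := @rV_open_ball R p p_pr d U y oU' Uy.
exists e; [exact: e0|move=> u /rV_ballE[_ h]; apply: he; apply/rV_ballE; split; first exact: e0].
move=> i; have := h i; rewrite !mxE opprD addrACA subrr addr0; exact.
Qed.

Lemma Rintegral_box_translate n (f : V -> R) z : box n z ->
  measurable_fun setT (f : BV -> R) ->
  mu.-integrable (box n) (EFin \o (fun x => f (x + z))) ->
  \int[mu]_(x in box n) f (x + z) = \int[mu]_(x in box n) f x.
Proof.
move=> nz mf intf; pose phi : V -> V := fun x => x + z.
have mphi : measurable_fun setT (phi : BV -> BV) by exact: measurable_translation.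
have phiB : phi @^-1` (box n) = box n.
  by apply/seteqP; split=> x; rewrite /= /phi => ?; apply/(box_addr x nz).
rewrite /Rintegral; congr fine.
have := @integral_pushforward _ _ _ _ _ _ mphi mu (box n) (EFin \o f).
rewrite phiB => <- //; last 2 first.
  exact/measurable_EFinP.
  exact: measurable_box0.
apply: eq_measure_integral => A mA _.
by rewrite /pushforward/= -(haar_translate mu_haar (- z) mA); under eq_fun do rewrite opprK.
Qed.

(** Orthogonality. If y is in the dual box the integrand is 1. Otherwise pick z
    in the box with |z . y| > 1; translating by z and by - z shows that the
    integral C satisfies 2 C = 2 cos(z . y) C with cos(z . y) <> 1. *)
Lemma integral_cos_dot n y : \int[mu]_(x in box n) padic_cos (dot x y) =
  \1_(box (dual n)) y * p%:R ^ (\sum_i n i).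
Proof.
have [ny|ny] := pselect (box (dual n) y).
  rewrite indicE mem_set// mul1r.
  rewrite (@eq_Rintegral _ _ _ _ _ (cst 1)) => [|x]; last first.
    by rewrite inE => nx /=; apply: padic_cos_eq1; exact: (dot_le nx).
  by rewrite Rintegral_cst// ?haar_box//= ?mul1r//; exact: measurable_box0.
rewrite indicE memNset// mul0r.
have [z nz zy] := box_perp ny.
set C := \int[mu]_(x in box n) padic_cos (dot x y).
have int_trans u :
    mu.-integrable (box n) (EFin \o (fun x : V => padic_cos (dot (x + u) y))).
  apply: integrable_box_bounded => [|x]; last exact: padic_cos_abs_le1.
  exact: (measurableT_comp (measurable_cos_dot y) (measurable_translation u)).
have trans u : box n u -> \int[mu]_(x in box n) padic_cos (dot (x + u) y) = C.
  move=> nu; apply: (@Rintegral_box_translate n (fun x => padic_cos (dot x y))) nu _ _.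
    exact: measurable_cos_dot.
  exact: int_trans.
have : C + C = 2 * padic_cos (dot z y) * C.
  have nz' : box n (- z) by exact/box_opp.
  rewrite -{1}(trans z nz) -[X in _ + X = _](trans (- z) nz').
  rewrite -RintegralD; [|exact: measurable_box0|exact: int_trans|exact: int_trans].
  rewrite -RintegralZl; [|exact: measurable_box0|exact: integrable_cos_dot].
  by apply: eq_Rintegral => x _; rewrite !dot_addl dot_opp padic_cosD.
move=> CC; apply/eqP; have := padic_cos_neq1 zy; apply: contraNT => C0.
by apply/eqP; apply: (mulIf C0); lra.
Qed.

End orthogonality.

(** * The Fourier transform integrated over a box *)

Lemma sigma_finite_measure_pack {R : realType} {dT : measure_display}
    {T : measurableType dT} (mu : {measure set T -> \bar R}) :
  sigma_finite [set: T] mu ->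
  exists nu : {sigma_finite_measure set T -> \bar R}, mu = nu.
Proof.
case: mu => m [m1 m2] sf.
pose H := @Measure_isSigmaFinite.Axioms_ dT T R m m1 m2 sf.
pose nu := HB.pack_for (SigmaFiniteMeasure.type T R) m m1 m2 H.
by exists nu; exact: eq_measure.
Qed.

Section fourier.
Context {R : realType} {p : nat} {p_pr : prime p} {d : nat}.
Local Notation Qp := (padic R p_pr).
Local Notation V := 'rV[Qp]_d.
Local Notation BV := (borel V).
Implicit Types (x y z : V) (n : 'I_d -> int).
Variable mu : {measure set BV -> \bar R}.
Hypothesis mu_haar : normalized_haar mu.

(** For x in the box, the value depends on y only through its coset modulo the
    dual box; on each of the countably many cosets it is a function of x. *)
Lemma measurable_cos_dot_pair n : measurable_fun ((box n : set BV) `*` [set: BV])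
  (fun xy : BV * BV => padic_cos (dot (xy.1 : V) (xy.2 : V))).
Proof.
move=> _ Y mY.
pose E (q : 'rV[rat]_d) : set (BV * BV) :=
  (box n `&` (fun x : BV => padic_cos (dot (x : V) (map_mx ratr q))) @^-1` Y) `*`
  [set y : V | box (dual n) (y - map_mx ratr q)].
rewrite (_ : _ `&` _ = \bigcup_q E q); last first.
  apply/seteqP; split=> [[x y] [[/= nx _] xyY]|[x y] [q _ [[/= nx xY] /= yq]]].
    have [q yq] := @rat_dense R p p_pr d (dual n) y.
    exists q; first by [].
    split; last exact: yq.
    split; first exact: nx.
    move: xyY; rewrite /preimage/= -{1}(subrK (map_mx ratr q : V) y) addrC.
    by rewrite (cos_dot_addr _ nx yq).
  split; first by split; [exact: nx|].
  rewrite /preimage/= -(subrK (map_mx ratr q : V) y) addrC.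
  by rewrite (cos_dot_addr _ nx yq).
apply: countable_bigcupT_measurable => [|q]; first exact: countableP.
apply: measurableX; last exact: measurable_box.
apply: measurableI; first exact: measurable_box0.
have := @measurable_cos_dot R p p_pr d (map_mx ratr q) measurableT Y mY.
by rewrite setTI.
Qed.

Section kernel.
Variables (g : V -> R).
Hypotheses (g_ge0 : forall y, 0 <= g y) (g_meas : measurable_fun setT (g : BV -> R)).
Hypothesis g_int : (\int[mu]_y (g y)%:E < +oo)%E.

(** The real part of the Fourier transform of a real function. *)
Definition cos_transform x : R := \int[mu]_y (padic_cos (dot x y) * g y).

(** Fubini and orthogonality: in the double integral, the integral over x of
    the character is mu(box) on the dual box and 0 elsewhere. *)
Lemma integral_cos_transform n : \int[mu]_(x in box n) cos_transform x =
  p%:R ^ (\sum_i n i) * \int[mu]_(y in box (dual n)) g y.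
Proof.
have [nu nuE] := sigma_finite_measure_pack (haar_sigma_finite mu_haar).
(* The character, cut off to x in the box, where it is jointly measurable. *)
pose F : BV * BV -> R :=
  (fun xy => padic_cos (dot (xy.1 : V) (xy.2 : V))) \_ ((box n : set BV) `*` [set: BV]).
pose f (xy : BV * BV) : \bar R := (F xy * g xy.2)%:E.
have mF : measurable_fun setT F.
  apply/(measurable_restrictT _ _).1; last exact: measurable_cos_dot_pair.
  by apply: measurableX => //; exact: measurable_box0.
have mf : measurable_fun setT f.
  apply/measurable_EFinP; apply: measurable_funM => //.
  exact: measurableT_comp.
have FE x y : F (x, y) = \1_(box n) x * padic_cos (dot x y).
  rewrite /F patchE indicE; case: ifPn => [|]; rewrite in_setX in_setT andbT => nx.
    by rewrite nx mul1r.
  by rewrite (negPf nx) mul0r.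
have mB := @measurable_box0 R p p_pr d n.
have muB : mu (box n) = (p%:R ^ (\sum_i n i))%:E by exact: haar_box.
have mg : measurable_fun setT (fun y : BV => (g y)%:E) by apply/measurable_EFinP.
(* An integrable bound for the integrand f. *)
pose G (xy : BV * BV) : \bar R := (\1_(box n) xy.1 * g xy.2)%:E.
have mG : measurable_fun setT G.
  apply/measurable_EFinP; apply: measurable_funM; last exact: measurableT_comp.
  apply: (measurableT_comp _ measurable_fst); exact: measurable_indic.
have Gint : (nu \x nu)%E.-integrable setT G.
  apply/(integrable21ltyP _ _ mG).2.
  suff : (\int[mu]_y \int[mu]_x `|G (x, y)| < +oo)%E by rewrite nuE.
  rewrite (eq_integral (fun y : BV => (p%:R ^ (\sum_i n i))%:E * (g y)%:E)%E) => [|y _].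
    rewrite ge0_integralZl_EFin ?exprz_ge0//.
    - by rewrite lte_mul_pinfty ?lee_fin ?exprz_ge0.
    - by move=> y _; rewrite lee_fin.
  rewrite (eq_integral (fun x : BV => (g y)%:E * (\1_(box n) x)%:E)%E) => [|x _].
    rewrite ge0_integralZl_EFin//.
    - by rewrite integral_indic// setIT muB muleC.
    - by apply/measurable_EFinP; exact: measurable_indic.
  by rewrite /G/= ger0_norm ?mulr_ge0// mulrC EFinM.
have fint : (nu \x nu)%E.-integrable setT f.
  apply: (le_integrable _ _ _ Gint) => // -[x y] _.
  rewrite /f /G FE/= lee_fin !normrM [`|g y|]ger0_norm// ler_wpM2r//.
  by rewrite ler_piMr// padic_cos_abs_le1.
have gint : mu.-integrable setT (fun y : BV => (g y)%:E).
  apply/integrableP; split=> //.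
  by under eq_integral => y _ do rewrite gee0_abs ?lee_fin//.
have cgint x : mu.-integrable setT (fun y : BV => (padic_cos (dot x y) * g y)%:E).
  apply: (le_integrable _ _ _ gint) => //.
    apply/measurable_EFinP; apply: measurable_funM => //.
    rewrite (_ : (fun y : BV => _) = (fun y : BV => padic_cos (dot y x))).
      exact: measurable_cos_dot.
    by apply/funext => y; rewrite dotC.
  move=> y _; rewrite lee_fin normrM [`|g y|]ger0_norm// ler_piMl//.
  exact: padic_cos_abs_le1.
have E : fine (\int[mu]_x \int[mu]_y f (x, y)) = fine (\int[mu]_y \int[mu]_x f (x, y)).
  by rewrite nuE (Fubini fint).
transitivity (fine (\int[mu]_x \int[mu]_y f (x, y))).
  rewrite /Rintegral integral_mkcond; congr fine; apply: eq_integral => x _.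
  rewrite patchE; case: ifPn => xB.
    rewrite /cos_transform /Rintegral fineK; last exact: integrable_fin_num.
    by apply: eq_integral => y _; rewrite /f FE indicE xB mul1r.
  by rewrite integral0_eq// => y _; rewrite /f FE indicE (negPf xB) !mul0r.
rewrite E -RintegralZl; last 2 first.
- exact: measurable_box0.
- by apply: integrableS gint => //; exact: measurable_box0.
rewrite /Rintegral [in RHS]integral_mkcond; congr fine; apply: eq_integral => y _.
transitivity (\int[mu]_(x in box n) (g y * padic_cos (dot x y)))%:E.
  rewrite /Rintegral fineK; last first.
    apply: integrable_fin_num => //.
    rewrite (_ : (fun x => _) = (fun x => (g y)%:E * (padic_cos (dot x y))%:E)%E)//.
    apply: integrableZl => //; exact: integrable_cos_dot.
  rewrite [RHS]integral_mkcond; apply: eq_integral => x _.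
  rewrite patchE /f FE indicE; case: ifPn => _; first by rewrite mul1r mulrC.
  by rewrite !mul0r.
rewrite RintegralZl//; last exact: integrable_cos_dot.
rewrite integral_cos_dot// patchE indicE; case: ifPn => _.
  by rewrite mul1r mulrC.
by rewrite mul0r mulr0.
Qed.
End kernel.
End fourier.

(** * The mass of exp(- a ||y||^b) on small boxes *)

Section radial_boxes.
Context {R : realType} {p : nat} {p_pr : prime p} {d : nat}.
Local Notation Qp := (padic R p_pr).
Local Notation V := 'rV[Qp]_d.
Local Notation BV := (borel V).
Variables (a b : R).
Hypotheses (a_gt0 : 0 < a) (b_gt0 : 0 < b).
Variable mu : {measure set BV -> \bar R}.
Hypothesis mu_haar : normalized_haar mu.
Local Notation g := (@radial R p p_pr d a b).
Local Notation I0 := (\int[mu]_(y in box (fun=> 0)) g y).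
Local Notation e1 := (expR (- (a * p%:R `^ b))).

Lemma integrable_radial (D : set BV) : measurable D ->
  mu.-integrable D (fun y => (g y)%:E).
Proof.
move=> mD; apply: (@integrableS _ _ _ mu setT) => //.
apply/integrableP; split; first exact: measurable_radialE.
rewrite (eq_integral (fun y : BV => (g y)%:E)).
  exact: integral_radial_lty.
by move=> y _; rewrite gee0_abs// lee_fin radial_ge0.
Qed.

(** All values |y_j| are at most p and one of them exceeds 1, hence equals p, by
    discreteness of the value group. *)
Lemma radial_shell (n : 'I_d -> int) (y : V) : (forall i, n i <= 1) ->
  box n y -> ~ box (fun=> 0) y -> g y = e1.
Proof.
move=> n1 ny /existsNP[i /negP]; rewrite expr0z -ltNge => yi.
have yp j : padic_abs (y 0 j) <= p%:R.
  by rewrite (le_trans (ny j))// -[leRHS]expr1z ler_weXz2l// ltW// p_gt1.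
have yip : padic_abs (y 0 i) = p%:R.
  by have [|//] := padic_abs_p_dichotomy (yp i); rewrite leNgt yi.
suff -> : g y = expR (- (a * max_norm y `^ b)) by congr (expR (- (a * _ `^ b))); apply/eqP;
  rewrite eq_le -{2}yip /max_norm le_bigmax andbT bigmax_le// ltW// p_gt0.
by [].
Qed.

Lemma integral_radial_box (n : 'I_d -> int) : (forall i, 0 <= n i <= 1) ->
  \int[mu]_(y in box n) g y = I0 + (p%:R ^ (\sum_i n i) - 1) * e1.
Proof.
move=> n01.
have m0 := @measurable_box0 R p p_pr d (fun=> 0).
have mn := @measurable_box0 R p p_pr d n.
have sub : (box (fun=> 0) : set BV) `<=` box n.
  move=> y y0 i; rewrite (le_trans (y0 i))// ler_weXz2l//; first by rewrite ltW// p_gt1.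
  by have /andP[] := n01 i.
have E : box n = (box (fun=> 0) : set BV) `|` (box n `\` box (fun=> 0)).
  by rewrite setDUK.
rewrite {1}E Rintegral_setU//; last 3 first.
- exact: measurableD.
- by rewrite -E; exact: integrable_radial.
- by apply/disj_setPS => y [y0 []].
congr (_ + _); rewrite (@eq_Rintegral _ _ _ _ _ (cst e1)).
  rewrite Rintegral_cst; last exact: measurableD.
  rewrite measureD//; last exact: haar_box_lty.
  rewrite setIidr// [X in fine (X - _)](haar_box mu_haar) [X in fine (_ - X)](haar_box_unit mu_haar) mulrC.
  by [].
move=> y; rewrite inE => -[ny y0] /=; apply: radial_shell ny y0.
by move=> i; have /andP[] := n01 i.
Qed.

Lemma integral_radial_unit_gt : e1 < I0.
Proof.
have m0 := @measurable_box0 R p p_pr d (fun=> 0).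
have m1 : mu (box (fun=> 0)) = 1%E by exact: haar_box_unit.
have one : (1 : R) `^ b = 1 by rewrite powR1.
apply: (@lt_le_trans _ _ (expR (- a))).
  rewrite ltr_expR ltrN2 ltr_pMr//.
  by rewrite -[ltLHS]one gt0_ltr_powR// ?nnegrE ?ler01 ?ltW ?p_gt0 ?p_gt1.
have -> : expR (- a) = \int[mu]_(y in box (fun=> 0)) cst (expR (- a)) y.
  by rewrite Rintegral_cst// m1 mulr1.
apply: le_Rintegral => //.
- apply: measurable_bounded_integrable => //.
    by rewrite m1 ltry.
  by exists (expR (- a)); split=> // r ar x _; rewrite /= ger0_norm ?expR_ge0// ltW.
- exact: integrable_radial.
move=> y y0; rewrite ler_expR lerN2 ler_piMr ?(ltW a_gt0)//.
rewrite -[leRHS]one ge0_ler_powR ?nnegrE ?ler01 ?(ltW b_gt0)//.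
  by rewrite /max_norm bigmax_idl le_max lexx.
by apply: bigmax_le => // i _; have := y0 i; rewrite expr0z.
Qed.

End radial_boxes.

(** * The law of the process at a fixed time *)

(** Events that agree on an almost sure event have the same probability. *)
Lemma probability_eq_on {R : realType} {dT : measure_display}
    {T : measurableType dT} (P : probability T R) (Z A B : set T) :
  measurable Z -> measurable A -> measurable B -> P Z = 1%E ->
  A `&` Z = B `&` Z -> P A = P B.
Proof.
move=> mZ mA mB PZ ABZ.
have PZC : P (~` Z) = 0%E by rewrite probability_setC// PZ subee.
have h C : measurable C -> P C = P (C `|` ~` Z).
  by move=> mC; rewrite measureU0//; exact: measurableC.
have hI C : C `|` ~` Z = (C `&` Z) `|` ~` Z by rewrite setUIl setUv setIT.
by rewrite (h A mA) (h B mB) (hI A) ABZ -hI.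
Qed.

Section marginal_law.
Context {R : realType} {p : nat} {p_pr : prime p} {d : nat}.
Local Notation Qp := (padic R p_pr).
Local Notation V := 'rV[Qp]_d.
Local Notation BV := (borel V).
Local Notation W := (path_space R V).
Variables (sigma b : R).
Hypotheses (sigma_gt0 : 0 < sigma) (b_gt0 : 0 < b).
Variable mu : {measure set BV -> \bar R}.
Hypothesis mu_haar : normalized_haar mu.
Variable P : probability W R.
Hypothesis P_law : max_norm_law mu sigma b P.

Lemma measurable_cylinder (t : R) (B : set BV) : 0 <= t -> measurable B ->
  measurable ([set w : W | B (w t)] : set W).
Proof. by move=> t0 mB; apply: sub_sigma_algebra; exists t => //; exists B. Qed.

Lemma measurable_origin : measurable ([set 0] : set BV).
Proof.
rewrite -[X in measurable X]setCK; apply: measurableC.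
apply: open_measurable_borel; apply: rV_ball_open => y /= y0.
have [i yi] : exists i, y 0 i != 0.
  apply: contrapT => /forallNP h; apply: y0; apply/rowP => i.
  by have /negP := h i; rewrite mxE negbK => /eqP.
exists (padic_abs (y 0 i)); first exact: padic_abs_gt0.
move=> u /rV_ballE[_ h] u0; have := h i.
by rewrite u0 mxE sub0r padic_absN ltxx.
Qed.

(** The law of the process is given through increments; as w 0 = 0 almost
    surely, the increment from time 0 can be replaced by the position. The
    event about the increment is measurable because it is a countable union,
    over the cosets of the box, of events about w 0 and w t separately. *)
Lemma marginal_increment (t : R) (n : 'I_d -> int) : 0 <= t ->
  P [set w : W | box n (w t)] = P [set w : W | box n (w t - w 0)].
Proof.
move=> t0; apply: (@probability_eq_on _ _ _ P [set w : W | w 0 = 0]).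
- exact: (measurable_cylinder (lexx 0) measurable_origin).
- exact: (measurable_cylinder t0 (measurable_box0 n)).
- pose D (q : 'rV[rat]_d) : set W := [set w : W | box n (w t - map_mx ratr q)] `&`
    [set w : W | box n (w 0 - map_mx ratr q)].
  rewrite (_ : [set w | _] = \bigcup_q D q).
    apply: countable_bigcupT_measurable => [|q]; first exact: countableP.
    have mq := measurable_box n (map_mx ratr q : V).
    apply: measurableI; first exact: (measurable_cylinder t0 mq).
    exact: (measurable_cylinder (lexx 0) mq).
  apply/seteqP; split=> [w /= wn|w [q _ [/= tq zq]]].
    have [q zq] := @rat_dense R p p_pr d n (w 0); exists q; first by [].
    by split; [exact: (box_trans wn zq)|exact: zq].
  have qz := (box_subC n _ _).1 zq.
  exact: (box_trans tq qz).
- exact: (law_start P_law).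
- by apply/seteqP; split=> w [/= wn w0]; split=> //; move: wn; rewrite /= w0 subr0.
Qed.

Lemma Re_rho (t : R) (x : V) :
  complex.Re (rho mu sigma b t x) = cos_transform mu (radial (sigma * t) b) x.
Proof.
apply: eq_Rintegral => y _.
by rewrite /= mulr0 subr0.
Qed.

Lemma probability_box (t : R) (n : 'I_d -> int) : 0 < t ->
  fine (P [set w : W | box n (w t)]) = p%:R ^ (\sum_i n i) *
    \int[mu]_(y in box (dual n)) radial (sigma * t) b y.
Proof.
move=> t0; rewrite marginal_increment ?ltW//.
transitivity (\int[mu]_(x in box n) complex.Re (rho mu sigma b (t - 0) x)).
  exact: (congr1 (fun z : R[i]%C => complex.Re z) (law_density P_law (lexx 0) t0 (measurable_box0 n))).
rewrite -(integral_cos_transform mu_haar).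
- by apply: eq_Rintegral => x _; rewrite Re_rho subr0.
- by move=> y; exact: radial_ge0.
- exact: measurable_radial.
- by apply: integral_radial_lty => //; rewrite mulr_gt0.
Qed.

Definition radii2 (i j : 'I_d) (r s : int) : 'I_d -> int :=
  fun k => (k == i)%:Z * r + (k == j)%:Z * s.

Lemma sum_radii2 i j r s : \sum_k radii2 i j r s k = r + s.
Proof.
rewrite big_split/=; congr (_ + _).
  by rewrite (bigD1 i)//= eqxx mul1r big1 ?addr0// => k /negPf ->; rewrite mul0r.
by rewrite (bigD1 j)//= eqxx mul1r big1 ?addr0// => k /negPf ->; rewrite mul0r.
Qed.

Lemma probability_box2 (t : R) (i j : 'I_d) (r s : int) : i != j -> 0 < t ->
  0 <= r <= 1 -> 0 <= s <= 1 ->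
  fine (P [set w : W | box (radii2 i j (- r) (- s)) (w t)]) = p%:R ^ (- (r + s)) *
    (\int[mu]_(y in box (fun=> 0)) radial (sigma * t) b y
     + (p%:R ^ (r + s) - 1) * expR (- (sigma * t * p%:R `^ b))).
Proof.
move=> ij t0 r01 s01; rewrite probability_box// sum_radii2 -opprD.
have -> : dual (radii2 i j (- r) (- s)) = radii2 i j r s.
  by apply/funext => k; rewrite /dual /radii2 !mulrN -opprD opprK.
rewrite (integral_radial_box _ _ mu_haar) ?sum_radii2 ?mulr_gt0// => k.
rewrite /radii2; have [->|ki] := eqVneq k i.
  by rewrite (negPf ij) mul1r mul0r addr0.
by rewrite mul0r add0r; case: eqP => _; rewrite ?mul1r ?mul0r.
Qed.

End marginal_law.

(** * Independence of the components *)

Section components.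
Context {R : realType} {p : nat} {p_pr : prime p} {d : nat}.
Local Notation Qp := (padic R p_pr).
Local Notation V := 'rV[Qp]_d.
Local Notation W := (path_space R V).

Lemma measurable_padic_ball (k : int) :
  measurable ([set x : Qp | padic_abs x <= p%:R ^ k] : set (borel Qp)).
Proof.
apply: sub_sigma_algebra; rewrite /= openE => x xk; apply/nbhs_ballP.
exists (p%:R ^ k); first by rewrite /= exprz_gt0// p_gt0.
move=> y /padic_ballE yx; rewrite /= -(subrK x y).
by apply: padic_absD_le => //; exact: ltW.
Qed.

Lemma independent_boxes (P : probability W R) (t : R) (n : 'I_d -> int) :
  independent_RVs P (@max_norm_component R p p_pr d t) ->
  P [set w : W | box n (w t)] =
  (\prod_i P (@max_norm_component R p p_pr d t i @^-1` [set x : Qp | (padic_abs x <= p%:R ^ n i)%R]))%E.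
Proof.
move=> /(_ finset.setT (fun i => [set x : Qp | padic_abs x <= p%:R ^ n i])).
move=> /(_ (fun i => measurable_padic_ball (n i))).
under [in RHS]eq_bigl do rewrite finset.in_setT.
move=> <-; congr (P _); apply/seteqP; split=> w wn.
  by move=> i _; exact: wn.
by move=> i; apply: wn; rewrite /= finset.in_setT.
Qed.

(** By independence the mass of a box is a product over the coordinates, so
    exchanging the radii in one coordinate between two boxes preserves the
    product of their masses. *)
Lemma independent_boxes2 (P : probability W R) (t : R) (i j : 'I_d) (r s : int) :
  i != j -> independent_RVs P (@max_norm_component R p p_pr d t) ->
  (P [set w : W | box (radii2 i j r s) (w t)] * P [set w : W | box (radii2 i j 0 0) (w t)] =
   P [set w : W | box (radii2 i j r 0) (w t)] * P [set w : W | box (radii2 i j 0 s) (w t)])%E.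
Proof.
move=> ij ind.
have split_ij r' s' : P [set w : W | box (radii2 i j r' s') (w t)] =
    (P (@max_norm_component R p p_pr d t i @^-1` [set x : Qp | (padic_abs x <= p%:R ^ r')%R]) *
    (P (@max_norm_component R p p_pr d t j @^-1` [set x : Qp | (padic_abs x <= p%:R ^ s')%R]) *
    \prod_(k | (k != i) && (k != j))
      P (@max_norm_component R p p_pr d t k @^-1` [set x : Qp | (padic_abs x <= 1)%R])))%E.
  rewrite independent_boxes// (bigD1 i)//= (bigD1 j)/=; last by rewrite eq_sym.
  rewrite /radii2 !eqxx (negPf ij) eq_sym (negPf ij) !mul0r addr0 add0r !mul1r.
  congr (_ * (_ * _))%E; apply: eq_bigr => k /andP[/negPf -> /negPf ->].
  by rewrite !mul0r addr0 expr0z.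
by rewrite !split_ij muleACA [RHS]muleACA; congr (_ * _)%E; rewrite muleACA [RHS]muleACA [X in (X * _)%E]muleC.
Qed.
End components.

(** The left side minus the right side is (q - 1)^2 e (I - e) / q^2. *)
Lemma box_masses_neq {R : realFieldType} (q e I : R) :
  1 < q -> 0 < e -> e < I ->
  q ^ (-2) * (I + (q ^ 2 - 1) * e) * I != (q ^ (-1) * (I + (q - 1) * e)) ^+ 2.
Proof.
move=> q1 e0 eI; have q0 : q != 0 by rewrite gt_eqF// (lt_trans _ q1).
rewrite -subr_eq0.
have -> : q ^ (-2) * (I + (q ^ 2 - 1) * e) * I - (q ^ (-1) * (I + (q - 1) * e)) ^+ 2 =
    (q - 1) ^+ 2 * e * (I - e) / q ^+ 2.
  by rewrite -[q ^ (-2)]/((q ^+ 2)^-1) -[q ^ (-1)]/(q^-1) -exprnP; field.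
by rewrite gt_eqF// !(divr_gt0, mulr_gt0, exprn_gt0)// ?subr_gt0// (lt_trans _ q1).
Qed.

Theorem mainTheorem3 (R : realType) (p : nat) (p_pr : prime p)
    (d : nat) (d_ge2 : (2 <= d)%N)
    (sigma b : R) (sigma_gt0 : 0 < sigma) (b_gt0 : 0 < b)
    (mu : {measure set (borel 'rV[padic R p_pr]_d) -> \bar R})
    (mu_haar : normalized_haar mu)
    (P : probability (path_space R 'rV[padic R p_pr]_d) R)
    (P_law : max_norm_law mu sigma b P)
    (t : R) (t_gt0 : 0 < t) :
  ~ independent_RVs P (@max_norm_component R p p_pr d t).
Proof.
move=> ind.
(* The two coordinates whose dependence is detected. *)
pose i : 'I_d := Ordinal (ltnW d_ge2); pose j : 'I_d := Ordinal d_ge2.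
have ij : i != j by [].
pose Q r s := fine (P [set w | box (radii2 i j (- r) (- s)) (w t)]).
pose e : R := expR (- (sigma * t * p%:R `^ b)).
pose I : R := \int[mu]_(y in box (fun=> 0)) radial (sigma * t) b y.
have QE r s : 0 <= r <= 1 -> 0 <= s <= 1 ->
    Q r s = p%:R ^ (- (r + s)) * (I + (p%:R ^ (r + s) - 1) * e).
  exact: (probability_box2 sigma_gt0 b_gt0 mu_haar P_law).
have fin (n : 'I_d -> int) : P [set w | box n (w t)] \is a fin_num.
  apply: fin_num_measure; apply: measurable_cylinder; first exact: ltW.
  exact: measurable_box0.
have QQ : Q 1 1 * Q 0 0 = Q 1 0 * Q 0 1.
  rewrite /Q oppr0 -!fineM//; congr fine; exact: independent_boxes2.
have st0 : 0 < sigma * t by rewrite mulr_gt0.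
have eI : e < I by exact: integral_radial_unit_gt.
have /eqP := box_masses_neq (@p_gt1 R p p_pr) (expR_gt0 _) eI.
apply; move: QQ; rewrite !QE//.
by rewrite !addr0 !add0r oppr0 !expr0z expr1z subrr mul0r addr0 mul1r expr2.
Qed.
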